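(* Let $P$ be a bounded ordered set with at least two elements and let $G$ be an arbitrary group. Then, for every infinite cardinal $\kappa$ such that $\kappa\ge\max\{|P|,|G|\}$, there exists a lattice $L$ with the following four properties: (a) $|\mathrm{Id}(L)|=2^\kappa$ but $|\mathrm{Filt}(L)|=\kappa=|L|$, so $L$ has more ideals than filters; (b) $\mathrm{Princ}(L)$ is isomorphic to $P$; (c) every principal congruence of $L$ is generated by a prime interval; (d) the automorphism group $\mathrm{Aut}(L)$ of $L$ is isomorphic to $G$.
   Context: Ordered sets are partially ordered sets (posets); a bounded ordered set is one having a least element and a greatest element. For a lattice $L$, $\mathrm{Filt}(L)$ and $\mathrm{Id}(L)$ denote the lattice of filters and the lattice of ideals of $L$, respectively. A congruence of $L$ is principal if it is generated by a single pair of elements of $L$, and $\mathrm{Princ}(L)$ denotes the set of principal congruences of $L$ ordered by inclusion. A prime interval is a two-element interval $[a,b]=\{a,b\}$ with $a<b$; a congruence is generated by the prime interval $[a,b]$ if it is the smallest congruence of $L$ containing the pair $(a,b)$.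
   Formalization: In (c), ''every principal congruence'' is read as every principal congruence other than the equality relation, because the equality relation is principal (generated by a pair (a,a)) but is never generated by a prime interval. *)

(* Defs.v *)
From HB Require Import structures.
From mathcomp Require Import all_boot all_order.
From mathcomp Require Import boolp classical_sets functions cardinality.

Set Implicit Arguments.
Unset Strict Implicit.
Unset Printing Implicit Defensive.

Import Order.Theory.
Local Open Scope classical_set_scope.
Local Open Scope order_scope.

Definition order_isomorphic d (P : porderType d) d' (Q : porderType d') : Prop :=
  exists f : P -> Q, bijective f /\ {mono f : x y / x <= y}.

Definition group_isomorphic (G H : groupType) : Prop :=
  exists f : G -> H, bijective f /\ {morph f : x y / (x * y)%g}.

Section LatticeNotions.
Context {d : Order.disp_t} (L : latticeType d).
Implicit Types (a b x y : L).

Definition is_ideal (I : set L) : Prop :=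
  [/\ I !=set0,
      forall x y, I y -> x <= y -> I x &
      forall x y, I x -> I y -> I (Order.join x y)].

Definition is_filter (F : set L) : Prop :=
  [/\ F !=set0,
      forall x y, F x -> x <= y -> F y &
      forall x y, F x -> F y -> F (Order.meet x y)].

Definition Id : set (set L) := [set I | is_ideal I].
Definition Filt : set (set L) := [set F | is_filter F].

Record is_congruence (theta : set (L * L)) : Prop := IsCongruence {
  congruence_refl : forall x, theta (x, x);
  congruence_sym : forall x y, theta (x, y) -> theta (y, x);
  congruence_trans : forall x y z,
    theta (x, y) -> theta (y, z) -> theta (x, z);
  congruence_meet : forall x x' y y', theta (x, x') -> theta (y, y') ->
    theta (Order.meet x y, Order.meet x' y');
  congruence_join : forall x x' y y', theta (x, x') -> theta (y, y') ->
    theta (Order.join x y, Order.join x' y')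
}.

Definition con a b : set (L * L) := smallest is_congruence [set (a, b)].

Definition is_principal (theta : set (L * L)) : Prop :=
  exists a b, theta = con a b.

Definition prime_interval a b : Prop :=
  a < b /\ [set x | a <= x <= b] = [set a; b].

(* The order is inherited from the inclusion order [subsetEset] on sets. *)
Definition Princ : Type := set_type [set theta | is_principal theta].
HB.instance Definition _ := SubChoice.on Princ.
HB.instance Definition _ :=
  [SubChoice_isSubPOrder of Princ by <: with set_display].

Definition is_lattice_automorphism (f : L -> L) : Prop :=
  [/\ bijective f, Order.meet_morphism f & Order.join_morphism f].

Definition Aut : Type := set_type [set f | is_lattice_automorphism f].
HB.instance Definition _ := SubChoice.on Aut.

Lemma AutP (f : Aut) : is_lattice_automorphism (val f).
Proof. exact: set_mem (valP f). Qed.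

Definition mkAut f (fP : is_lattice_automorphism f) : Aut :=
  exist _ f (mem_set fP).

Lemma is_lattice_automorphism_id : is_lattice_automorphism idfun.
Proof. by split => //; exists idfun. Qed.

Lemma is_lattice_automorphism_comp (f g : L -> L) :
  is_lattice_automorphism f -> is_lattice_automorphism g ->
  is_lattice_automorphism (f \o g).
Proof.
move=> [fb fI fU] [gb gI gU]; split; first exact: bij_comp.
  by move=> x y /=; rewrite gI fI.
by move=> x y /=; rewrite gU fU.
Qed.

Lemma is_lattice_automorphism_inv (f : L -> L) :
  is_lattice_automorphism f ->
  {g | is_lattice_automorphism g & cancel f g /\ cancel g f}.
Proof.
move=> [fb fI fU]; apply: cid2.
have [g fK gK] := fb; exists g => //; split; first by exists f.
  by move=> x y; apply: (can_inj fK); rewrite fI !gK.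
by move=> x y; apply: (can_inj fK); rewrite fU !gK.
Qed.

Definition Aut_one : Aut := mkAut is_lattice_automorphism_id.
Definition Aut_mul (f g : Aut) : Aut :=
  mkAut (is_lattice_automorphism_comp (AutP f) (AutP g)).
Definition Aut_inv (f : Aut) : Aut :=
  mkAut (s2valP (is_lattice_automorphism_inv (AutP f))).

Lemma Aut_mulA : associative Aut_mul.
Proof. by move=> f g h; apply: val_inj. Qed.

Lemma Aut_mul1 : left_id Aut_one Aut_mul.
Proof. by move=> f; apply: val_inj. Qed.

Lemma Aut_1mul : right_id Aut_one Aut_mul.
Proof. by move=> f; apply: val_inj. Qed.

Lemma Aut_mulV : left_inverse Aut_one Aut_inv Aut_mul.
Proof.
move=> f; apply: val_inj; apply/funext => x /=.
by case: is_lattice_automorphism_inv => g /= _ [fK _]; exact: fK.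
Qed.

Lemma Aut_Vmul : right_inverse Aut_one Aut_inv Aut_mul.
Proof.
move=> f; apply: val_inj; apply/funext => x /=.
by case: is_lattice_automorphism_inv => g /= _ [_ gK]; exact: gK.
Qed.

HB.instance Definition _ :=
  isGroup.Build Aut Aut_mulA Aut_mul1 Aut_1mul Aut_mulV Aut_Vmul.

End LatticeNotions.

Arguments Id {d} L.
Arguments Filt {d} L.
Arguments Princ {d} L.
Arguments Aut {d} L.

(* Main.v *)
Require Import Defs.
From HB Require Import structures.
From mathcomp Require Import all_boot all_order finmap.
From mathcomp Require Import boolp classical_sets functions cardinality.
From mathcomp Require Import wochoice.

(** The lattice is built from a set of points, as a family of closed sets
    ordered by inclusion and stable under intersection.  The points are sorted
    into cells, and certain infinite sets of points, the blocks, are singled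
    out so that two distinct blocks either are nested or meet inside a single
    cell ([inc_same_cell]).  Some points lie above another point of their cell.
    The closed sets are the whole space, the blocks, and the small sets: the
    finite subsets of a cell that are closed downwards.

    _Filters and ideals._  The inclusion order on closed sets is well founded
    ([lat_wf]).  This yields joins, as least upper bounds, and it makes every
    filter principal, so there are as many filters as elements.  One of the
    cells is an antichain of kappa points, the marks; all of its finite
    subsets are closed, so each of its 2 ^ kappa subsets gives an ideal.  That
    the lattice has only kappa elements rests on kappa * kappa = kappa
    ([pairing]).

    _Congruences._  Each point carries a color in P, and color 1 is exactly the
    color of the minimal points.  For q in P let [alpha q] relate two closed
    sets that have the same points of color not below q.  This relation is
    evidently an equivalence compatible with intersection.  The work is in
    compatibility with joins ([alpha_join]), and the incidences of the points
    of color other than 1 are chosen for it.  Conversely [con e f], for e < f,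
    is [alpha q] with q the largest color of a point of f outside e
    ([con_color]).  If some minimal point is collapsed then so is everything:
    joining it with two far away points identifies each of these with the top
    ([far_atoms], [congruence_total]).  For 0 < p < 1 there is a pair of
    blocks, the lower and the upper block of p, that differ only in points of
    color at most p; they form a prime interval generating [alpha p].  For
    p < q a three-element chain (a gadget) placed under both upper blocks
    transfers a collapse of the q-interval to the p-interval, and not back:
    its meets with the lower q-block, the lower p-block and both upper blocks
    are its one-, two- and three-element initial parts.

    _Automorphisms._  Marks are recognizable because they are the atoms with
    infinitely many atoms in their cell, and two atoms lie in one cell exactly
    when their join is small.  Each index k has its mark on a block [OrdB k],
    and further cells record on these blocks a well-order of the index set.
    An automorphism induces an automorphism of this well-order, hence fixes
    each [OrdB k].  The blocks [GrpB g] are then permuted, and cells joining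
    [GrpB g] to [GrpB (g * h)] that are marked by an index labelled h force
    the permutation to commute with right translations; it is therefore a left
    translation.  Finally an automorphism that fixes all blocks is trivial,
    because nearly all points are cut out by intersections of two blocks
    ([aut_fix_id]). *)

Set Implicit Arguments.
Unset Strict Implicit.
Unset Printing Implicit Defensive.
Import Order.Theory.
Local Open Scope classical_set_scope.
Local Open Scope card_scope.

(** * Cardinal arithmetic and well-orders *)

Lemma infinite_nat_inj T (A : set T) :
  infinite_set A -> exists2 nu : nat -> T, injective nu & forall n, A (nu n).
Proof.
move=> /[dup] /infinite_setN0 [x0 _] /infiniteP.
elim/Ppointed: T => T in A x0 *; first by case: (no x0).
move=> /pcard_leP [f]; exists f.
  by move=> m n; apply: 'inj_f; rewrite inE.
by move=> n; exact: 'funS_f.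
Qed.

Lemma infinite_two T (A : set T) :
  infinite_set A -> exists x y, [/\ A x, A y & x <> y].
Proof.
move=> /infinite_nat_inj [nu nu_inj Anu].
by exists (nu 0), (nu 1); split => // /nu_inj.
Qed.

(** A maximal partial bijection between the two sets exhausts one of them.
    The injections are given as relations, which spares the case of an empty
    codomain. *)
Lemma card_comparable T U (A : set T) (B : set U) :
  (exists R : T -> U -> Prop,
     [/\ forall a, A a -> exists2 b, B b & R a b
       & forall a a' b, R a b -> R a' b -> a = a'])
  \/ (exists R : U -> T -> Prop,
     [/\ forall b, B b -> exists2 a, A a & R b a
       & forall b b' a, R b a -> R b' a -> b = b']).
Proof.
pose ok (F : set (T * U)) :=
  (forall a b, F (a, b) -> A a /\ B b) /\
  (forall a b a' b', F (a, b) -> F (a', b') -> (a = a' <-> b = b')).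
have [F [[FAB Finj] Fmax]] : exists F, ok F /\ forall F', F `<` F' -> ~ ok F'.
  apply: Zorn_bigcup => C Cok Ctot; split.
    by move=> a b [X CX Xab]; exact: (Cok X CX).1 Xab.
  move=> a b a' b' [X CX Xab] [Y CY Yab'].
  have [XY|YX] := Ctot X Y CX CY.
    by apply: (Cok Y CY).2 => //; exact: XY.
  by apply: (Cok X CX).2 => //; exact: YX.
have [[a0 Aa0 Na0]|Fl] := pselect (exists2 a, A a & forall b, ~ F (a, b)); last first.
  left; exists (fun a b => F (a, b)); split.
    move=> a Aa; apply: contra_notP Fl => NF; exists a => // b Fab.
    by apply: NF; exists b => //; case: (FAB _ _ Fab).
  by move=> a a' b Fab Fab'; apply/(Finj _ _ _ _ Fab Fab').
right; exists (fun b a => F (a, b)); split; last first.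
  by move=> b b' a Fab Fab'; apply/(Finj _ _ _ _ Fab Fab').
move=> b Bb; apply: contrapT => NF.
have Nb a : ~ F (a, b).
  by move=> Fab; apply: NF; exists a => //; case: (FAB _ _ Fab).
apply: (Fmax (F `|` [set (a0, b)])).
  split; first by move=> x; left.
  by move=> /(_ (a0, b) (or_intror erefl)); exact: Na0.
split=> [a c [/FAB//|[-> ->]]//|a c a' c' [Fac|[-> ->]] [Fac'|[-> ->]]].
- exact: Finj.
- by split=> [?|?]; subst; [case: (Na0 _ Fac)|case: (Nb _ Fac)].
- by split=> [?|?]; subst; [case: (Na0 _ Fac')|case: (Nb _ Fac')].
- by [].
Qed.

(** Hessenberg's theorem kappa * kappa = kappa, in the form of a pairing
    function.  Take a maximal injection F of a square A * A into A (as a graph,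
    with A infinite).  If the complement of A injects into A, then so does the
    whole set, and F can be transported.  Otherwise the complement contains a
    copy of A, and the three new quarters of the square of A with this copy
    adjoined can be injected into the copy, against maximality. *)
Lemma pairing (K : Type) : infinite_set [set: K] ->
  exists f : K -> K -> K,
    forall x y x' y', f x y = f x' y' -> x = x' /\ y = y'.
Proof.
move=> Kinf.
pose square (F : set (K * K * K)) (A : set K) :=
  [/\ forall x y, (A x /\ A y) <-> exists z, F (x, y, z),
      forall x y z z', F (x, y, z) -> F (x, y, z') -> z = z',
      forall x y x' y' z, F (x, y, z) -> F (x', y', z) -> x = x' /\ y = y' &
      forall x y z, F (x, y, z) -> A z].
pose ok F := F = set0 \/ exists2 A, square F A & infinite_set A.
have [F [Fok Fmax]] : exists F, ok F /\ forall F', F `<` F' -> ~ ok F'.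
  apply: Zorn_bigcup => C Cok Ctot.
  have [[X0 CX0 /eqP X00]|C0] := pselect (exists2 X, C X & X != set0); last first.
    left; apply/seteqP; split=> // x [X CX Xx]; apply: C0; exists X => //.
    by apply/set0P; exists x.
  have sqC X w : C X -> X w -> exists2 A, square X A & infinite_set A.
    by move=> CX Xw; case: (Cok X CX) => // Xe; rewrite Xe in Xw.
  have join w w' : (\bigcup_(X in C) X) w -> (\bigcup_(X in C) X) w' ->
      exists X A, [/\ C X, square X A, X w & X w'].
    move=> [X CX Xw] [Y CY Yw']; have [XY|YX] := Ctot X Y CX CY.
      have [A sA _] := sqC Y w' CY Yw'; exists Y, A; split => //; exact: XY.
    have [A sA _] := sqC X w CX Xw; exists X, A; split => //; exact: YX.
  right; exists [set x | exists z, (\bigcup_(X in C) X) (x, x, z)].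
    split.
    - move=> x y; split.
        move=> [[z Uz] [z' Uz']].
        have [X [A [CX [Xdom _ _ _] Xz Xz']]] := join _ _ Uz Uz'.
        have [Ax _] : A x /\ A x by apply/Xdom; exists z.
        have [Ay _] : A y /\ A y by apply/Xdom; exists z'.
        by have [w Xw] := (Xdom x y).1 (conj Ax Ay); exists w, X.
      move=> [z Uz].
      have [X [A [CX [Xdom _ _ _] Xz _]]] := join _ _ Uz Uz.
      have [Ax Ay] : A x /\ A y by apply/Xdom; exists z.
      split.
        by have [w Xw] := (Xdom x x).1 (conj Ax Ax); exists w, X.
      by have [w Xw] := (Xdom y y).1 (conj Ay Ay); exists w, X.
    - move=> x y z z' Uz Uz'.
      have [X [A [CX [_ Xf _ _] Xz Xz']]] := join _ _ Uz Uz'; exact: Xf Xz Xz'.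
    - move=> x y x' y' z Uz Uz'.
      have [X [A [CX [_ _ Xi _] Xz Xz']]] := join _ _ Uz Uz'; exact: Xi Xz Xz'.
    - move=> x y z Uz.
      have [X [A [CX [Xdom _ _ Xr] Xz _]]] := join _ _ Uz Uz.
      have Az := Xr _ _ _ Xz.
      by have [w Xw] := (Xdom z z).1 (conj Az Az); exists w, X.
  have /set0P [w X0w] : X0 != set0 by apply/eqP.
  have [A [Adom _ _ _]] := sqC X0 w CX0 X0w; apply: contra_not.
  apply: sub_finite_set => x Ax.
  by have [z X0z] := (Adom x x).1 (conj Ax Ax); exists z, X0.
have {Fok} [A [Fdom Ffun Finj Fran] Ainf] : exists2 A, square F A & infinite_set A.
  case: Fok => // F0.
  have [nu nu_inj _] := infinite_nat_inj Kinf.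
  pose F' := [set w | exists m n, w = (nu m, nu n, nu (choice.pickle (m, n)))].
  exfalso; apply: (Fmax F').
    rewrite F0; split=> // /(_ (nu 0, nu 0, nu (choice.pickle (0, 0)))).
    by apply; exists 0, 0.
  right; exists (range nu).
    split.
    - move=> x y; split.
        by move=> [[m _ <-] [n _ <-]]; exists (nu (choice.pickle (m, n))), m, n.
      by move=> [z [m [n [-> -> _]]]]; split; [exists m | exists n].
    - move=> x y z z' [m [n [-> -> ->]]] [m' [n' [/nu_inj -> /nu_inj -> ->]]] //.
    - move=> x y x' y' z [m [n [-> -> ->]]] [m' [n' [-> -> /nu_inj]]].
      by move=> /(pcan_inj choice.pickleK) [-> ->].
    - by move=> x y z [m [n [_ _ ->]]]; exists (choice.pickle (m, n)).
  apply/infiniteP/card_subP; exists (range nu) => //.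
  by apply: card_esym; rewrite card_eq_sym; apply: inj_card_eq => ? ? _ _ /nu_inj.
have [c0 [c1 [Ac0 Ac1 c01]]] := infinite_two Ainf.
have /choice [f' f'P] (xy : K * K) : exists z, A xy.1 -> A xy.2 -> F (xy.1, xy.2, z).
  have [[Ax Ay]|NA] := pselect (A xy.1 /\ A xy.2).
    by have [z Fz] := (Fdom _ _).1 (conj Ax Ay); exists z.
  by exists c0 => Ax Ay; case: NA.
pose f x y := f' (x, y).
have fP x y : A x -> A y -> F (x, y, f x y) by exact: (f'P (x, y)).
have fA x y : A x -> A y -> A (f x y) by move=> Ax Ay; exact: Fran (fP _ _ Ax Ay).
have f_inj x y x' y' : A x -> A y -> A x' -> A y' -> f x y = f x' y' ->
    x = x' /\ y = y'.
  move=> Ax Ay Ax' Ay' e; apply: (Finj _ _ _ _ (f x y)); first exact: fP.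
  by rewrite e; exact: fP.
have [[R [Rtot Rinj]]|[R [Rtot Rinj]]] := card_comparable A (~` A); last first.
  have /choice [e eP] x : exists y, A y /\
      ((A x /\ y = f c0 x) \/ (~ A x /\ exists2 a, A a /\ R x a & y = f c1 a)).
    have [Ax|NAx] := pselect (A x).
      by exists (f c0 x); split; [exact: fA|left].
    have [a Aa Rxa] := Rtot x NAx; exists (f c1 a); split; first exact: fA.
    by right; split=> //; exists a.
  have eA x : A (e x) by case: (eP x).
  have e_inj x y : e x = e y -> x = y.
    case: (eP x) (eP y) => _ [[Ax ->]|[_ [a [Aa Ra] ->]]] [_ [[Ay ->]|[_ [b [Ab Rb] ->]]]].
    - by move=> /(f_inj _ _ _ _ Ac0 Ax Ac0 Ay) [].
    - by move=> /(f_inj _ _ _ _ Ac0 Ax Ac1 Ab) [].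
    - by move=> /(f_inj _ _ _ _ Ac1 Aa Ac0 Ay) [/esym].
    - by move=> /(f_inj _ _ _ _ Ac1 Aa Ac1 Ab) [_ ab]; subst b; exact: Rinj Ra Rb.
  exists (fun x y => f (e x) (e y)) => x y x' y'.
  by move=> /(f_inj _ _ _ _ (eA _) (eA _) (eA _) (eA _)) [/e_inj -> /e_inj ->].
have /choice [g gP] a : exists b, A a -> ~ A b /\ R a b.
  have [Aa|NAa] := pselect (A a); last by exists c0.
  by have [b NAb Rab] := Rtot a Aa; exists b.
have gN a : A a -> ~ A (g a) by move=> /gP [].
have g_inj a b : A a -> A b -> g a = g b -> a = b.
  by move=> /gP [_ Ra] /gP [_ Rb] e; rewrite e in Ra; exact: Rinj Ra Rb.
(* [r x] is the element of [A] of which [x] is a copy, and [t x] records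
   whether [x] is the original or the copy. *)
pose A' := A `|` (g @` A).
have /choice [r rP] x : exists a, A' x -> A a /\ (a = x \/ (g a = x /\ ~ A x)).
  have [[Ax|[a Aa <-]]|NA] := pselect (A' x); last by exists c0.
    by exists x; split=> //; left.
  by exists a; split=> //; right; split=> //; exact: gN.
pose t x := if pselect (A x) then c0 else c1.
have At x : A (t x) by rewrite /t; case: pselect.
have Ar x : A' x -> A (r x) by move=> /rP [].
have rt_inj x y : A' x -> A' y -> r x = r y -> t x = t y -> x = y.
  move=> A'x A'y; rewrite /t.
  case: (rP x A'x) => Arx Hx; case: (rP y A'y) => Ary Hy rxy.
  case: pselect => Ax; case: pselect => Ay //; last 1 first.
  - case: Hx => [e|[ex _]]; first by case: Ax; rewrite -e.
    case: Hy => [e|[ey _]]; first by case: Ay; rewrite -e.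
    by move=> _; rewrite -ex -ey rxy.
  - by case: Hx Hy => [ex|[_ //]] [ey|[_ //]] _; rewrite -ex -ey.
  - by move=> /esym.
pose code x y := f (f (t x) (t y)) (f (r x) (r y)).
have codeA x y : A' x -> A' y -> A (code x y).
  by move=> A'x A'y; apply: (fA); apply: fA => //; exact: Ar.
pose new w := [/\ A' w.1.1, A' w.1.2, ~ (A w.1.1 /\ A w.1.2)
                & w.2 = g (code w.1.1 w.1.2)].
exfalso; apply: (Fmax (F `|` new)).
  split; first by move=> w; left.
  have A'g : A' (g c0) by right; exists c0.
  move=> sub; have Fg : F (g c0, g c0, g (code (g c0) (g c0))).
    by apply: sub; right; split=> // -[/(gN _ Ac0)].
  have [Agc _] : A (g c0) /\ A (g c0).
    by apply/Fdom; exists (g (code (g c0) (g c0))).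
  exact: gN Agc.
have newN x y z : new (x, y, z) -> ~ A z.
  by move=> [/= A'x A'y _ ->]; apply/gN/codeA.
right; exists A'; last first.
  by apply: contra_not Ainf; apply: sub_finite_set => x; left.
split.
- move=> x y; split=> [[A'x A'y]|[z [Fz|[]//]]].
    have [Axy|NA] := pselect (A x /\ A y).
      by have [z Fz] := (Fdom _ _).1 Axy; exists z; left.
    by exists (g (code x y)); right; split.
  by have [Ax Ay] : A x /\ A y by [apply/Fdom; exists z]; split; left.
- move=> x y z z' [Fz|Nz] [Fz'|Nz'].
  + exact: Ffun Fz Fz'.
  + by case: Nz' => _ _ []; apply/Fdom; exists z.
  + by case: Nz => _ _ []; apply/Fdom; exists z'.
  + by case: Nz Nz' => _ _ _ /= -> [_ _ _ /= ->].
- move=> x y x' y' z [Fz|Nz] [Fz'|Nz'].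
  + exact: Finj Fz Fz'.
  + by case: (newN _ _ _ Nz'); exact: Fran Fz.
  + by case: (newN _ _ _ Nz); exact: Fran Fz'.
  + case: Nz Nz' => /= A'x A'y _ -> [/= A'x' A'y' _].
    move=> /(g_inj _ _ (codeA _ _ A'x A'y) (codeA _ _ A'x' A'y')).
    have fAt a b : A (f (t a) (t b)) by exact: fA.
    have fAr a b : A' a -> A' b -> A (f (r a) (r b)).
      by move=> ? ?; apply: fA; exact: Ar.
    move=> /(f_inj _ _ _ _ (fAt _ _) (fAr _ _ A'x A'y) (fAt _ _) (fAr _ _ A'x' A'y')).
    move=> [/(f_inj _ _ _ _ (At _) (At _) (At _) (At _)) [txx' tyy']].
    move=> /(f_inj _ _ _ _ (Ar _ A'x) (Ar _ A'y) (Ar _ A'x') (Ar _ A'y')) [rxx' ryy'].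
    by split; apply: rt_inj.
- move=> x y z [/Fran Az|[/= A'x A'y _ ->]]; first by left.
  by right; exists (code x y) => //; exact: codeA.
Qed.

(** The iterated pairing of the letters determines a word once its length is
    known. *)
Lemma seq_coding (K : Type) : infinite_set [set: K] ->
  exists c : seq K -> K, injective c.
Proof.
move=> Kinf; have [f f_inj] := pairing Kinf.
have [nu nu_inj _] := infinite_nat_inj Kinf.
exists (fun s => f (nu (size s)) (foldr f (nu 0) s)).
elim=> [|x s IHs] [|y s'] //= /f_inj [/nu_inj //= [ss'] /f_inj [-> e]].
by congr (_ :: _); apply: IHs; rewrite ss' e.
Qed.

Lemma well_ordering (K : Type) : exists lt : K -> K -> Prop,
  [/\ well_founded lt, forall x y z, lt x y -> lt y z -> lt x z,
      forall x, ~ lt x x & forall x y, x <> y -> lt x y \/ lt y x].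
Proof.
elim/Peq: K => K.
have [R Rwo] := well_ordering_principle K.
have wo : wo_chain R predT by move=> A _; exact: Rwo.
have tot x y : R x y || R y x by apply: (wo_chainW wo).
have refl x : R x x by apply: (wo_chain_reflexive wo).
have anti x y : R x y && R y x -> x = y by apply: (wo_chain_antisymmetric wo).
pose lt x y := ~~ R y x.
have least (A : set K) : A !=set0 -> exists2 z, A z & forall x, A x -> R z x.
  move=> [x Ax]; have [|z [[Az zA] _]] := Rwo (fun y => `[< A y >]).
    by exists x; apply/asboolP.
  by exists z; [apply/asboolP|move=> y Ay; apply: zA; apply/asboolP].
exists lt; split.
- move=> x; apply: contrapT => Nx.
  have [z Nz zmin] := least [set x | ~ Acc lt x] (ex_intro _ x Nx).
  apply: Nz; split=> y yz; apply: contrapT => Ny.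
  by move: yz; rewrite /lt (zmin y Ny).
- move=> x y z; rewrite /lt => xy yz; apply/negP => zx.
  have [w Aw wmin] := least [set x; y; z] (ex_intro _ x (or_introl (or_introl erefl))).
  have wx : R w x by apply: wmin; left; left.
  have wy : R w y by apply: wmin; left; right.
  have wz : R w z by apply: wmin; right.
  case: Aw => [[]|] /= e; subst w.
  + have exz : x = z by apply: anti; rewrite wz zx.
    subst z; case/orP: (tot x y) => r; first by rewrite r in yz.
    by rewrite r in xy.
  + by rewrite wx in xy.
  + by rewrite wy in yz.
- by move=> x; rewrite /lt refl.
- move=> x y xy; rewrite /lt; case/orP: (tot x y) => r; [left|right].
    by apply/negP => r'; apply: xy; apply: anti; rewrite r.
  by apply/negP => r'; apply: xy; apply: anti; rewrite r r'.
Qed.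

Lemma injective_card_le T U (f : T -> U) : injective f -> [set: T] #<= [set: U].
Proof.
move=> f_inj; apply/card_subP; exists (range f) => //.
by apply: inj_card_eq => x y _ _ /f_inj.
Qed.

Lemma injective_range_card_le T U (f : T -> U) (A : set U) :
  injective f -> (forall x, A (f x)) -> [set: T] #<= A.
Proof.
move=> f_inj fA; apply/card_subP; exists (range f); last by move=> _ [x _ <-].
by apply: inj_card_eq => x y _ _ /f_inj.
Qed.

Lemma cantor T : ~ ([set: set T] #<= [set: T]).
Proof.
move=> /pcard_surjP [g gsurj].
have [x _ gx] := gsurj [set x | ~ g x x] I.
have : g x x <-> ~ g x x by rewrite {1}gx.
tauto.
Qed.

(** Stands for membership in a sequence, with [T] lacking decidable equality. *)
Definition listed T (s : seq T) : set T := [set x | has (fun y => `[< y = x >]) s].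

Lemma finite_listed T (A : set T) : finite_set A -> exists s, A = listed s.
Proof.
elim/Peq: T => T in A *; move=> /finite_seqP [s ->]; exists s.
apply/seteqP; split=> x /=.
  by move=> xs; apply/hasP; exists x => //; apply/asboolP.
by move=> /hasP [y ys /asboolP <-].
Qed.

Lemma card_le_injective T U :
  [set: U] !=set0 -> [set: T] #<= [set: U] -> exists f : T -> U, injective f.
Proof.
elim/Ppointed: U => U; first by case=> u; case: (no u).
move=> _ /pcard_injP [f f_inj]; exists f => x y; apply: f_inj; exact: in_setT.
Qed.

Lemma injective_surjection T U (f : T -> U) : [set: T] !=set0 -> injective f ->
  exists g : U -> T, forall x, exists y, g y = x.
Proof.
move=> [x0 _] f_inj.
have /choice [g gP] (y : U) : exists x, forall x', f x' = y -> x' = x.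
  have [[x xy]|N] := pselect (exists x, f x = y).
    by exists x => x'; rewrite -xy => /f_inj.
  by exists x0 => x' x'y; case: N; exists x'.
by exists g => x; exists (f x); apply/esym/gP.
Qed.

Lemma finite_set_Acc T (A : set T) :
  finite_set A -> Acc (fun B C : set T => B `<` C) A.
Proof.
elim/Pchoice: T => T in A *.
suff H n (B : set T) : finite_set B -> (#|` fset_set B| < n)%N ->
    Acc (fun B C : set T => B `<` C) B.
  by move=> Afin; exact: (H _ A Afin (ltnSn _)).
elim: n B => [|n IH] B Bfin; first by rewrite ltn0.
rewrite ltnS => Bn; constructor => C CB.
have Cfin : finite_set C by apply: sub_finite_set Bfin; exact: properW.
apply: IH => //; apply: leq_trans Bn; apply: fproper_ltn_card.
rewrite fproperEneq; apply/andP; split.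
  by apply/eqP => /(fset_set_inj Cfin Bfin) e; case: CB => _; rewrite e; apply.
by rewrite -fset_set_sub; [exact: properW|by []|by []].
Qed.

Local Open Scope order_scope.

(** * Well-founded lattices, congruences, automorphisms *)

(** Used twice: for joins, as least upper bounds, and for filters. *)
Lemma wf_meet_least d (L : meetSemilatticeType d) (F : set L) :
  well_founded (fun x y : L => x < y) -> F !=set0 ->
  (forall x y, F x -> F y -> F (Order.meet x y)) ->
  exists2 m, F m & forall x, F x -> m <= x.
Proof.
move=> wf [x Fx] FI; elim/(well_founded_ind wf): x Fx => x IH Fx.
have [xmin|/existsNP [y /not_implyP [Fy /negP Nxy]]] :=
  pselect (forall y, F y -> x <= y); first by exists x.
apply: (IH (Order.meet x y)); last exact: FI.
by rewrite lt_neqAle leIl andbT; apply: contra Nxy => /eqP <-; exact: leIr.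
Qed.

(** By well-foundedness every filter is principal. *)
Lemma card_Filt_wf d (L : latticeType d) :
  well_founded (fun x y : L => x < y) -> Filt L #= [set: L].
Proof.
move=> wf; apply: card_esym.
have -> : Filt L = range (fun x : L => [set y | x <= y]).
  apply/seteqP; split=> [F [F0 FS FI]|_ [x _ <-]].
    have [m Fm mF] := wf_meet_least wf F0 FI; exists m => //.
    by apply/seteqP; split=> y; [exact: FS|exact: mF].
  split; first by exists x => /=.
    by move=> y z /= xy /(le_trans xy).
  by move=> y z /= xy xz; rewrite lexI xy.
apply: card_esym; apply: inj_card_eq => x y _ _ e; apply: le_anti.
have /= yx := congr1 (fun F : set L => F x) e.
have /= xy := congr1 (fun F : set L => F y) e.
by apply/andP; split; [rewrite xy | rewrite -yx].
Qed.

Section Congruences.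
Context {d : Order.disp_t} {L : latticeType d}.
Implicit Types (e f g : L) (theta : set (L * L)).

(** For a relation compatible with meets, compatibility with joins need only be
    checked on comparable pairs, since e and f are related iff both are
    related to their meet. *)
Lemma is_congruence_le theta :
  (forall e, theta (e, e)) ->
  (forall e f, theta (e, f) -> theta (f, e)) ->
  (forall e f g, theta (e, f) -> theta (f, g) -> theta (e, g)) ->
  (forall e f g, theta (e, f) -> theta (Order.meet e g, Order.meet f g)) ->
  (forall e f g, e <= f -> theta (e, f) ->
     theta (Order.join e g, Order.join f g)) ->
  is_congruence theta.
Proof.
move=> refl sym trans tI tU_le.
have tU e f g : theta (e, f) -> theta (Order.join e g, Order.join f g).
  move=> ef; have me : theta (Order.meet e f, e).
    by have := tI _ _ e (sym _ _ ef); rewrite meetxx meetC.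
  have mf : theta (Order.meet e f, f) by have := tI _ _ f ef; rewrite meetxx.
  apply: (trans _ (Order.join (Order.meet e f) g)).
    by apply/sym/tU_le => //; exact: leIl.
  by apply: tU_le => //; exact: leIr.
split=> // e e' f f' ee' ff'.
  apply: trans (tI _ _ f ee') _; rewrite meetC [X in (_, X)]meetC; exact: tI.
by apply: trans (tU _ _ f ee') _; rewrite joinC [X in (_, X)]joinC; exact: tU.
Qed.

Lemma is_congruence_con e f : is_congruence (con e f).
Proof.
split.
- by move=> x th [cth _]; exact: congruence_refl.
- by move=> x y xy th [cth eth]; apply: congruence_sym => //; exact: xy.
- move=> x y z xy yz th [cth eth].
  by apply: (congruence_trans cth (y := y)); [exact: xy|exact: yz].
- move=> x x' y y' xx' yy' th [cth eth].
  by apply: (congruence_meet cth); [exact: xx'|exact: yy'].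
- move=> x x' y y' xx' yy' th [cth eth].
  by apply: (congruence_join cth); [exact: xx'|exact: yy'].
Qed.

Lemma con_gen e f : con e f (e, f).
Proof. by move=> th [_]; apply. Qed.

Lemma con_sub theta e f : is_congruence theta -> theta (e, f) ->
  con e f `<=` theta.
Proof. by move=> cth eth; apply: smallest_sub => // _ ->. Qed.

Section Fixed.
Variables (theta : set (L * L)) (theta_congr : is_congruence theta).

Lemma congruence_meetr e f g :
  theta (e, f) -> theta (Order.meet e g, Order.meet f g).
Proof. by move=> ef; apply: congruence_meet => //; exact: congruence_refl. Qed.

Lemma congruence_joinr e f g :
  theta (e, f) -> theta (Order.join e g, Order.join f g).
Proof. by move=> ef; apply: congruence_join => //; exact: congruence_refl. Qed.

Lemma congruence_meet_join e f :
  theta (e, f) <-> theta (Order.meet e f, Order.join e f).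
Proof.
split=> [ef|mj].
  apply: (congruence_trans theta_congr (y := f)).
    by have := congruence_meetr f ef; rewrite meetxx.
  apply: congruence_sym => //.
  by have := congruence_joinr f ef; rewrite joinxx.
apply: (congruence_trans theta_congr (y := Order.meet e f)).
  have := congruence_meetr e mj.
  rewrite (meet_l (leIl e f)) (meet_r (leUl e f)).
  exact: (congruence_sym theta_congr).
have := congruence_meetr f mj.
by rewrite (meet_l (leIr f e)) (meet_r (leUr f e)).
Qed.

End Fixed.

Lemma con_meet_join e f : con e f = con (Order.meet e f) (Order.join e f).
Proof.
apply/seteqP; split; apply: con_sub.
- exact: is_congruence_con.
- have c := is_congruence_con (Order.meet e f) (Order.join e f).
  apply/(congruence_meet_join c e f); exact: con_gen.
- exact: is_congruence_con.
- have c := is_congruence_con e f.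
  have [H _] := congruence_meet_join c e f; apply: H; exact: con_gen.
Qed.

Lemma con_refl e : con e e = diagonal.
Proof.
apply/seteqP; split; last first.
  move=> [x y] /diagonalP ->.
  exact: (congruence_refl (is_congruence_con e e)).
apply: con_sub; last by apply/diagonalP.
split.
- by move=> x; apply/diagonalP.
- by move=> x y /diagonalP ->; apply/diagonalP.
- by move=> x y z /diagonalP -> /diagonalP ->; apply/diagonalP.
- by move=> x x' y y' /diagonalP -> /diagonalP ->; apply/diagonalP.
- by move=> x x' y y' /diagonalP -> /diagonalP ->; apply/diagonalP.
Qed.

Lemma order_automorphism (f : L -> L) :
  bijective f -> {mono f : x y / x <= y} -> is_lattice_automorphism f.
Proof.
move=> fbij fmono; have [g fK gK] := fbij; split=> // x y; apply: le_anti.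
  rewrite lexI !fmono leIl leIr.
  by rewrite -[X in X <= _]gK fmono lexI -!(fmono (g _)) !gK leIl leIr.
rewrite leUx !fmono leUl leUr andTb.
by rewrite -[X in _ <= X]gK fmono leUx -!(fmono _ (g _)) !gK leUl leUr.
Qed.

Lemma automorphism_mono (f : L -> L) :
  is_lattice_automorphism f -> {mono f : x y / x <= y}.
Proof.
by move=> [/bij_inj finj fI _] x y; rewrite !leEmeet -fI (inj_eq finj).
Qed.

End Congruences.

(** * Points, cells and blocks *)

(** The choices on which the construction depends: a well-order of the index
    set, an embedding of the colors in it, and a labelling of the indices by
    the group in which every group element occurs. *)
Record coding dP (P : tbPOrderType dP) (G : groupType) (K : Type) := Coding {
  klt : K -> K -> Prop;
  klt_wf : well_founded klt;
  klt_trans : forall k l m, klt k l -> klt l m -> klt k m;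
  klt_irr : forall k, ~ klt k k;
  klt_total : forall k l, k <> l -> klt k l \/ klt l k;
  anchor : P -> K;
  anchor_inj : injective anchor;
  label : K -> G;
  label_surj : forall g, exists k, label k = g;
  idx_infinite : infinite_set [set: K];
  bot_neq_top : \bot <> \top :> P
}.

Section IndexOrder.
Context {dP : Order.disp_t} {P : tbPOrderType dP} {G : groupType} {K : Type}.
Variable D : coding P G K.

Lemma klt_asym k l : klt D k l -> ~ klt D l k.
Proof. by move=> kl lk; apply: (klt_irr (klt_trans kl lk)). Qed.

Lemma klt_neq k l : klt D k l -> k <> l.
Proof. by move=> kl e; rewrite e in kl; exact: klt_irr kl. Qed.

End IndexOrder.

Ltac absurd_order :=
  match goal with
  | H : is_true (?p < ?q), H' : is_true (?q < ?p) |- _ =>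
      exfalso; move: (lt_trans H H'); rewrite ltxx; discriminate
  | H : is_true (?p < ?p) |- _ => exfalso; move: H; rewrite ltxx; discriminate
  | H : klt _ ?k ?l, H' : klt _ ?l ?k |- _ => by case: (klt_asym H H')
  | H : klt _ ?k ?k |- _ => by case: (klt_irr H)
  end.
Ltac cancel_label :=
  match goal with
  | H : (?g * ?h)%g = (?g' * ?h)%g |- _ => move: (mulIg _ _ _ H) => ?; subst
  end.
(** For finite case analyses over the shapes of points and blocks, whose
    impossible cases rest on the asymmetry of the two orders or on cancelling a
    label. *)
Ltac site_cases :=
  intuition (subst; try congruence; try absurd_order; try (cancel_label; congruence)).

(** [Mark k] are the points of the antichain cell behind the ideals.  For
    k < l the pair [OrdLow k l], [OrdHigh k l] records the order of k and l.
    The pair [ActSrc g k], [ActTgt g k] records that g is sent to its product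
    with the label of k.  [ColPt p k] provide infinitely many minimal points in
    the blocks of p; [ColTop p] distinguishes these two blocks and, lying on
    [OrdB (anchor p)] only, makes p recognizable among the colors.
    [GadBot p q], [GadMid p q], [GadTop p q] are the gadget of p < q. *)
Inductive site (P G K : Type) :=
| Mark of K
| OrdLow of K & K
| OrdHigh of K & K
| ActSrc of G & K
| ActTgt of G & K
| ColPt of P & K
| ColTop of P
| GadBot of P & P
| GadMid of P & P
| GadTop of P & P.
Arguments Mark {P G K}.
Arguments OrdLow {P G K}.
Arguments OrdHigh {P G K}.
Arguments ActSrc {P G K}.
Arguments ActTgt {P G K}.
Arguments ColPt {P G K}.
Arguments ColTop {P G K}.
Arguments GadBot {P G K}.
Arguments GadMid {P G K}.
Arguments GadTop {P G K}.

Inductive cell_name (P G K : Type) :=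
| MarkCell
| OrdCell of K & K
| ActCell of G & K
| ColCell of P & K
| GadCell of P & P.
Arguments MarkCell {P G K}.
Arguments OrdCell {P G K}.
Arguments ActCell {P G K}.
Arguments ColCell {P G K}.
Arguments GadCell {P G K}.

Inductive block_name (P G K : Type) :=
| OrdB of K
| GrpB of G
| LowB of P
| UpB of P.
Arguments OrdB {P G K}.
Arguments GrpB {P G K}.
Arguments LowB {P G K}.
Arguments UpB {P G K}.

Section Points.
Context {dP : Order.disp_t} {P : tbPOrderType dP} {G : groupType} {K : Type}.
Variable D : coding P G K.
Local Notation pt := (site P G K).
Local Notation nm := (block_name P G K).
Implicit Types (k l : K) (g : G) (p q : P) (x y z : pt) (n m : nm).
Local Notation lt := (klt D).
Local Notation anchor := (anchor D).
Local Notation label := (label D).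

(** Only these colors get blocks of their own: color 0 is equality and color 1
    is the color of all minimal points. *)
Definition proper p := p <> \bot /\ p <> \top.

(** The side conditions are kept out of the type of points, so that case
    analyses over several points need no dependent elimination. *)
Definition valid : set pt := fun x =>
  match x with
  | OrdLow k l | OrdHigh k l => lt k l
  | ColPt p _ | ColTop p => proper p
  | GadBot p q | GadMid p q | GadTop p q => proper p /\ proper q /\ p < q
  | _ => True
  end.

(** The point immediately below x, or x itself if x is minimal.  Chains have at
    most three points, so [base] below is the minimal point under x. *)
Definition lower x : pt :=
  match x with
  | ColTop p => ColPt p (anchor p)
  | GadMid p q => GadBot p q
  | GadTop p q => GadMid p q
  | _ => x
  end.

Definition base x := lower (lower x).

Definition cell x : cell_name P G K :=
  match x with
  | Mark _ => MarkCell
  | OrdLow k l | OrdHigh k l => OrdCell k l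
  | ActSrc g k | ActTgt g k => ActCell g k
  | ColPt p k => ColCell p k
  | ColTop p => ColCell p (anchor p)
  | GadBot p q | GadMid p q | GadTop p q => GadCell p q
  end.

Definition color x : P :=
  match x with
  | ColTop p => p
  | GadMid p q => q
  | GadTop p q => p
  | _ => \top
  end.

(** Incidence of blocks and points.  Of the chain of p < q, the lower q-block
    contains the first point and the lower p-block the first two, while both
    upper blocks contain all three; this asymmetry makes a collapse pass from
    q to p only. *)
Definition inc n x : Prop :=
  match n, x with
  | OrdB k, Mark l => l = k
  | OrdB k, OrdLow a b => a = k \/ b = k
  | OrdB k, OrdHigh a b => b = k
  | OrdB k, ActTgt g l => l = k
  | OrdB k, ColPt p l => l = k
  | OrdB k, ColTop p => anchor p = k
  | GrpB g, ActSrc g' k => g' = g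
  | GrpB g, ActTgt g' k => (g' * label k)%g = g
  | LowB p, ColPt q _ => q = p
  | LowB p, GadBot a b => a = p \/ b = p
  | LowB p, GadMid a b => a = p
  | UpB p, (ColPt q _ | ColTop q) => q = p
  | UpB p, (GadBot a b | GadMid a b | GadTop a b) => a = p \/ b = p
  | _, _ => False
  end.

Definition ok n : Prop :=
  match n with LowB p | UpB p => proper p | _ => True end.

Definition block n : set pt := [set x | valid x /\ inc n x].

Definition nested n m : Prop :=
  match n, m with LowB p, UpB q => p = q | _, _ => False end.

Definition lower_closed (A : set pt) := forall x, A x -> A (lower x).

(** Small sets are contained in one cell, but [MarkCell] is infinite, so
    finiteness has to be required. *)
Definition small (A : set pt) : Prop :=
  [/\ finite_set A, A `<=` valid, lower_closed A &
      forall x y, A x -> A y -> cell x = cell y].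

Definition closed (A : set pt) : Prop :=
  [\/ A = valid, (exists2 n, ok n & A = block n) | small A].

Lemma lower_lower x : lower (lower (lower x)) = lower (lower x).
Proof. by case: x. Qed.

Lemma valid_lower x : valid x -> valid (lower x).
Proof. by case: x. Qed.

Lemma cell_lower x : cell (lower x) = cell x.
Proof. by case: x. Qed.

Lemma inc_lower n x : inc n x -> inc n (lower x).
Proof. by case: n x => [k|g|p|p] [] //= *; subst; auto. Qed.

Lemma lower_closed_valid : lower_closed valid.
Proof. by move=> x; exact: valid_lower. Qed.

Lemma lower_closed_block n : lower_closed (block n).
Proof. by move=> x [vx nx]; split; [exact: valid_lower|exact: inc_lower]. Qed.

(** The property of blocks on which everything rests: it makes the closed sets
    stable under intersection. *)
Lemma inc_same_cell n m x y : valid x -> valid y ->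
  inc n x -> inc n y -> inc m x -> inc m y ->
  [\/ n = m, nested n m, nested m n | cell x = cell y].
Proof.
case: (pselect (n = m)) => [->|nm]; first by constructor 1.
case: (pselect (nested n m)) => [|Nnm]; first by constructor 2.
case: (pselect (nested m n)) => [|Nmn]; first by constructor 3.
move=> vx vy nx ny mx my; constructor 4; move: nm Nnm Nmn vx vy nx ny mx my.
case: n => n; case: m => m; case: x => /=; try (by intuition);
case: y => /=; try (by intuition).
all: site_cases.
Qed.

Lemma inc_Mark n k : inc n (Mark k) -> n = OrdB k.
Proof. by case: n => //= l ->. Qed.

Lemma cell_finite x : cell x <> MarkCell ->
  finite_set [set y | cell y = cell x].
Proof.
case: x => [k|k l|k l|g k|g k|p k|p|p q|p q|p q] //= _;
  [apply: (sub_finite_set (B := [set OrdLow k l; OrdHigh k l])); last exact: finite_set2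
  |apply: (sub_finite_set (B := [set OrdLow k l; OrdHigh k l])); last exact: finite_set2
  |apply: (sub_finite_set (B := [set ActSrc g k; ActTgt g k])); last exact: finite_set2
  |apply: (sub_finite_set (B := [set ActSrc g k; ActTgt g k])); last exact: finite_set2
  |apply: (sub_finite_set (B := [set ColPt p k; ColTop p])); last exact: finite_set2
  |apply: (sub_finite_set (B := [set ColPt p (anchor p); ColTop p])); last exact: finite_set2
  |apply: (sub_finite_set (B := [set GadBot p q; GadMid p q; GadTop p q])); last exact: finite_set3
  |apply: (sub_finite_set (B := [set GadBot p q; GadMid p q; GadTop p q])); last exact: finite_set3
  |apply: (sub_finite_set (B := [set GadBot p q; GadMid p q; GadTop p q])); last exact: finite_set3];
by case=> //= *; site_cases.
Qed.

Lemma finite_block_inter n m : n <> m -> ~ nested n m -> ~ nested m n ->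
  finite_set (block n `&` block m).
Proof.
move=> nm Nnm Nmn.
have [[x [[vx nx] [_ mx]]]|no] := pselect ((block n `&` block m) !=set0);
  last first.
  by apply: sub_finite_set (finite_set0 _) => x nmx; apply: no; exists x.
apply: (sub_finite_set _ (cell_finite (x := x) _)) => [y [[vy ny] [_ my]]/=|].
  by case: (inc_same_cell vx vy nx ny mx my).
case: x nx mx {vx} => // k nx mx _; apply: nm.
by rewrite (inc_Mark nx) (inc_Mark mx).
Qed.

Lemma nestedP n m : nested n m -> exists2 p, n = LowB p & m = UpB p.
Proof. by case: n m => // p [] // q; exists p => //; congr UpB. Qed.

Lemma block_nested n m : nested n m -> block n `<=` block m.
Proof.
case: n m => // p [] //= q <- x [vx px]; split=> //; move: px.
by case: x vx => //= *; site_cases.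
Qed.

Lemma small_sub A B : small A -> B `<=` A -> lower_closed B -> small B.
Proof.
move=> [Afin Av _ Ac] BA Bp; split=> //.
- exact: sub_finite_set Afin.
- by move=> x /BA /Av.
- by move=> x y /BA Ax /BA Ay; exact: Ac.
Qed.

Lemma closed_valid A : closed A -> A `<=` valid.
Proof. by case=> [->//|[n _ ->] x []//|[]]. Qed.

Lemma closed_lower A : closed A -> lower_closed A.
Proof.
by case=> [->|[n _ ->]|[]//]; [exact: lower_closed_valid|exact: lower_closed_block].
Qed.

Lemma closed_small A : small A -> closed A.
Proof. by constructor 3. Qed.

(** Two blocks that are not nested meet in a small set: by [inc_same_cell] the
    meet lies in one cell, which is not the infinite one since a mark lies on a
    single block. *)
Lemma closedI A B : closed A -> closed B -> closed (A `&` B).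
Proof.
move=> Acl Bcl.
have ABp : lower_closed (A `&` B).
  by move=> x [Ax Bx]; split; [exact: closed_lower Ax|exact: closed_lower Bx].
case: (Acl) => [->|[n on An]|Asm].
- by rewrite setIidr //; exact: closed_valid.
- case: (Bcl) => [->|[m om Bm]|Bsm].
  + by rewrite setIidl //; exact: closed_valid.
  + have [?|nm] := pselect (n = m); last have [Nnm|Nnm] := pselect (nested n m).
    * by subst; rewrite setIid; constructor 2; exists m.
    * by subst; rewrite setIidl; [constructor 2; exists n|exact: block_nested].
    * have [Nmn|Nmn] := pselect (nested m n).
        by subst; rewrite setIidr; [constructor 2; exists m|exact: block_nested].
      constructor 3; split=> //.
      - by subst; exact: finite_block_inter.
      - by move=> x [/(closed_valid Acl)].
      - move=> x y [+ +] [+ +]; rewrite An Bm => -[vx nx] [_ mx] [vy ny] [_ my].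
        by case: (inc_same_cell vx vy nx ny mx my).
  + by constructor 3; apply: (small_sub Bsm) => // x [].
- by constructor 3; apply: (small_sub Asm) => // x [].
Qed.

Lemma inj_infinite (f : K -> pt) (A : set pt) (k0 : K) :
  injective f -> (forall k, k <> k0 -> A (f k)) -> infinite_set A.
Proof.
move=> f_inj Af Afin; apply: (idx_infinite D).
have Ifin : finite_set (f @` (setT `\ k0)).
  by apply: sub_finite_set Afin => _ [k [_ /= kk0] <-]; exact: Af.
have : finite_set ([set: K] `\ k0).
  by rewrite -(eq_finite_set (inj_card_eq (f := f) _)) // => x y _ _ /f_inj.
move=> fin; apply: (sub_finite_set (B := (setT `\ k0) `|` [set k0])).
  by move=> k _; have [->|?] := pselect (k = k0); [right|left].
by rewrite finite_setU.
Qed.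

Definition atomic x := lower x = x.

(** Blocks contain infinitely many minimal points, which tells them from small
    sets in terms of the lattice. *)
Lemma block_atoms_infinite n : ok n ->
  infinite_set (block n `&` atomic).
Proof.
have [k0 _] := infinite_setN0 (idx_infinite D).
case: n => [k|g|p|p] on.
- apply: (@inj_infinite
      (fun l => if `[< lt k l >] then OrdLow k l else OrdLow l k) _ k).
    move=> l l'; do 2 case: ifPn => [/asboolP ?|/asboolP ?].
    + by case.
    + by case=> *; subst.
    + by case=> *; subst.
    + by case.
  move=> l lk; case: ifPn => /asboolP kl; first by split=> //; split=> //=; left.
  split=> //; split; last by right.
  by case: (klt_total D lk).
- apply: (@inj_infinite (ActSrc g) _ k0) => [l l' []//|l _].
  by split.
- apply: (@inj_infinite (ColPt p) _ k0) => [l l' []//|l _].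
  by split.
- apply: (@inj_infinite (ColPt p) _ k0) => [l l' []//|l _].
  by split.
Qed.

Lemma block_not_small n : ok n -> ~ small (block n).
Proof.
move=> on [fin _ _ _]; apply: (block_atoms_infinite on).
exact: finite_setIl.
Qed.

Lemma block_sub n m : ok n -> block n `<=` block m -> n = m \/ nested n m.
Proof.
move=> on nm; apply: contrapT => /not_orP [Nnm Nnm'].
have [Nmn|Nmn] := pselect (nested m n).
  case: m n Nmn on nm {Nnm Nnm'} => // p [] //= q <- op /(_ (ColTop p)) [] //.
have := finite_block_inter Nnm Nnm' Nmn; rewrite setIidl // => fin.
by apply: (block_atoms_infinite on); exact: finite_setIl.
Qed.

Lemma block_inj n m : ok n -> ok m -> block n = block m -> n = m.
Proof.
move=> on om e.
have [//|nm] : n = m \/ nested n m by apply: block_sub => //; rewrite e.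
have [//|mn] : m = n \/ nested m n by apply: block_sub => //; rewrite e.
by case: n m nm mn {on om e} => // p [].
Qed.

(** The smallest block that contains, with the base of a chain, also the points
    above it. *)
Definition up_name n : nm := if n is LowB p then UpB p else n.

Lemma inc_base_up n x : inc n (base x) -> inc (up_name n) x.
Proof. by rewrite /base; case: n x => [k|g|p|p] [] //= *; site_cases. Qed.

Lemma ok_up n : ok n -> ok (up_name n).
Proof. by case: n. Qed.

Lemma nonatomic_base x y :
  lower x <> x -> cell y = cell x -> base y = base x.
Proof.
by rewrite /base; case: x y => [?|? ?|? ?|? ?|? ?|? ?|?|? ?|? ?|? ?] [] //= *; site_cases.
Qed.

Lemma base_atomic x : atomic (base x).
Proof. exact: lower_lower. Qed.

Lemma color_atomic x : atomic x -> color x = \top.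
Proof. by case: x => // p q; rewrite /atomic. Qed.

(** A point x above another one has a proper color p, and it is the first point
    of its chain that separates the two blocks of p. *)
Lemma color_nonatomic x : valid x -> lower x <> x ->
  [/\ proper (color x), inc (LowB (color x)) (lower x),
      inc (UpB (color x)) x & ~ inc (LowB (color x)) x].
Proof.
case: x => //= [p px|p q [pp [pq ltpq]]|p q [pp [pq ltpq]]] _; split; auto.
by move=> e; subst; absurd_order.
Qed.

Lemma color_neq_bot x : valid x -> color x <> \bot.
Proof.
move=> vx; have [ax|/color_nonatomic [] // []//] := pselect (lower x = x).
by rewrite color_atomic // => /esym; exact: bot_neq_top D.
Qed.

Lemma color_up p x : valid x -> inc (UpB p) x -> ~ inc (LowB p) x -> color x <= p.
Proof.
case: x => //= [q _ ->//|a b [_ [_ /ltW ab]] + +|a b [_ [_ /ltW ab]] + _].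
  by case=> -> //.
by case=> <-.
Qed.

(** The point x itself need not do: the top of the gadget of a < p has
    color a only, but then the middle of that gadget has color p. *)
Lemma color_low p x A : lower_closed A -> A `<=` valid -> A x ->
  inc (LowB p) (base x) -> ~ inc (LowB p) x ->
  exists2 y, A y & ~ inc (LowB p) y /\ p <= color y.
Proof.
move=> Ap Av; rewrite /base; case: x => //= [q Aq <- _|a b Aab|a b Aab].
- by exists (ColTop q) => //=; split.
- by case=> [->//|<- ab]; exists (GadMid a b).
- case=> [? _|? ab]; subst.
    by exists (GadTop p b) => //=; split => // -[].
  exists (GadMid a p); first exact: (Ap (GadTop a p)).
  split=> //= ap; have [_ [_]] := Av _ Aab; rewrite ap ltxx; discriminate.
Qed.

(** No closed set other than the whole space contains two far points, see
    [far_top]. *)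
Definition far x y := cell x <> cell y /\ forall n, inc n x -> ~ inc n y.

Lemma idx_avoid k l :
  exists k1 k2, [/\ k1 <> k2, k1 <> k, k1 <> l, k2 <> k & k2 <> l].
Proof.
have : infinite_set ([set: K] `\` [set k; l]).
  by apply: infinite_setD; [exact: idx_infinite D|exact: finite_set2].
move=> /infinite_two [k1 [k2 [[_ n1] [_ n2] k12]]]; exists k1, k2.
by split=> // e; [apply: n1|apply: n1|apply: n2|apply: n2]; rewrite e; (left + right).
Qed.

(** Marks are far from almost all points outside their cell, because a point
    lies on at most two blocks of the form [OrdB k].  Marks themselves are far
    from the points that lie on the single block [GrpB 1]. *)
Lemma far_atoms x : valid x -> exists y z,
  [/\ valid y /\ atomic y, valid z /\ atomic z, y <> z, far x y & far x z].
Proof.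
have [k0 _] := infinite_setN0 (idx_infinite D).
have marks k l : (forall j : K, inc (OrdB j) x -> j = k \/ j = l) ->
    cell x <> MarkCell -> exists y z,
    [/\ valid y /\ atomic y, valid z /\ atomic z, y <> z, far x y & far x z].
  move=> xkl xM; have [k1 [k2 [k12 k1k k1l k2k k2l]]] := idx_avoid k l.
  exists (Mark k1), (Mark k2); split=> //; first (by case); split=> //.
    by move=> n nx /inc_Mark e; subst n; case: (xkl _ nx).
  by move=> n nx /inc_Mark e; subst n; case: (xkl _ nx).
case: x marks => [k|k l|k l|g k|g k|p k|p|p q|p q|p q] marks vx; last first.
- by apply: (marks k0 k0) => // j /=; site_cases.
- by apply: (marks k0 k0) => // j /=; site_cases.
- by apply: (marks k0 k0) => // j /=; site_cases.
- by apply: (marks (anchor p) k0) => // j /=; site_cases.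
- by apply: (marks k k0) => // j /=; site_cases.
- by apply: (marks k k0) => // j /=; site_cases.
- by apply: (marks k k0) => // j /=; site_cases.
- by apply: (marks k l) => // j /=; site_cases.
- by apply: (marks k l) => // j /=; site_cases.
have [k1 [k2 [k12 _ _ _ _]]] := idx_avoid k k.
exists (ActSrc 1%g k1), (ActSrc 1%g k2); split=> //; first (by case);
  by split=> // n /inc_Mark ->.
Qed.

End Points.

(** * The lattice of closed sets *)

Section Lattice.
Context {dP : Order.disp_t} {P : tbPOrderType dP} {G : groupType} {K : Type}.
Variable D : coding P G K.
Local Notation pt := (site P G K).
Local Notation nm := (block_name P G K).
Implicit Types (k l : K) (g : G) (p q : P) (x y z : pt) (n m : nm).

Definition lat : Type := set_type (closed D : set (set pt)).
HB.instance Definition _ := SubChoice.on lat.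
HB.instance Definition _ :=
  [SubChoice_isSubPOrder of lat by <: with set_display].

Definition pts (e : lat) : set pt := val e.
Definition lat_of A (cA : closed D A) : lat := exist _ A (mem_set cA).

Implicit Types (e f : lat).

Lemma closed_pts e : closed D (pts e).
Proof. exact: set_mem (valP e). Qed.

Lemma pts_inj e f : pts e = pts f -> e = f.
Proof. exact: val_inj. Qed.

Lemma pts_le e f : (e <= f) = (pts e `<=` pts f) :> Prop.
Proof. by rewrite leEsub subsetEset. Qed.

Lemma pts_leP e f : reflect (pts e `<=` pts f) (e <= f).
Proof. by apply: (iffP idP); rewrite pts_le. Qed.

Definition lat_meet e f : lat := lat_of (closedI (closed_pts e) (closed_pts f)).

Lemma lat_meetP e f f' : (e <= lat_meet f f') = (e <= f) && (e <= f').
Proof.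
apply/pts_leP/andP => [s|[/pts_leP s /pts_leP s'] x ex].
  by split; apply/pts_leP => x /s [].
by split; [exact: s|exact: s'].
Qed.

HB.instance Definition _ :=
  Order.POrder_isMeetSemilattice.Build set_display lat lat_meetP.

Lemma pts_lt e f : e < f -> pts e `<` pts f.
Proof.
rewrite lt_neqAle => /andP [/eqP ef /pts_leP s]; split=> // s'; apply: ef.
by apply: pts_inj; apply/seteqP.
Qed.

(** Below a small set there are finitely many closed sets.  Below a block there
    are only small sets and, for an upper block, one further block. *)
Lemma lat_wf : well_founded (fun e f : lat => e < f).
Proof.
have Asmall e : small D (pts e) -> Acc (fun e f : lat => e < f) e.
  move=> [/finite_set_Acc eacc _ _ _].
  suff H A : Acc (fun B C : set pt => B `<` C) A ->
      forall f, pts f = A -> Acc (fun e f : lat => e < f) f by exact: H eacc _ _.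
  elim=> {}A _ IH f fA; constructor=> h /pts_lt hf.
  by apply: (IH (pts h)) => //; rewrite -fA.
have Alow e p : proper p -> pts e = block D (LowB p) -> Acc (fun e f : lat => e < f) e.
  move=> op ep; constructor => f /pts_lt [fe Nfe].
  case: (closed_pts f) => [fv|[n on fn]|]; last exact: Asmall.
    by case: Nfe => x /(closed_valid (closed_pts e)); rewrite fv.
  have [nE|/nestedP [? _ //]] : n = LowB p \/ nested n (LowB p).
      by apply: (block_sub (D := D)) => //; rewrite -fn -ep.
    by case: Nfe; rewrite ep fn nE.
have Ablock e n : ok n -> pts e = block D n -> Acc (fun e f : lat => e < f) e.
  move=> on en; constructor => f /pts_lt [fe Nfe].
  case: (closed_pts f) => [fv|[m om fm]|]; last exact: Asmall.
    by case: Nfe => x /(closed_valid (closed_pts e)); rewrite fv.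
  have [mE|/nestedP [p mE _]] : m = n \/ nested m n.
      by apply: (block_sub (D := D)) => //; rewrite -fm -en.
    by case: Nfe; rewrite en fm mE.
  by apply: (Alow f p); [rewrite mE in om|rewrite fm mE].
move=> e; constructor=> f /pts_lt [fe Nfe].
case: (closed_pts f) => [fv|[m om fm]|]; last exact: Asmall.
  by case: Nfe => x /(closed_valid (closed_pts e)); rewrite fv.
exact: Ablock fm.
Qed.

Definition lat_top : lat := lat_of (Or31 _ _ (erefl (valid D))).

Lemma le_lat_top e : e <= lat_top.
Proof. by apply/pts_leP; exact: closed_valid (closed_pts e). Qed.

(** The space is an upper bound, so well-foundedness gives a least one. *)
Lemma lat_join_exists e f :
  exists j : lat, forall h : lat, (j <= h) = (e <= h) && (f <= h).
Proof.
pose U := [set h : lat | (e <= h) && (f <= h)].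
have U0 : U !=set0 by exists lat_top; rewrite /U /= !le_lat_top.
have UI h h' : U h -> U h' -> U (Order.meet h h').
  by move=> /andP [eh fh] /andP [eh' fh']; rewrite /U /= !lexI eh fh eh' fh'.
have [j /andP [ej fj] jmin] := wf_meet_least lat_wf U0 UI.
exists j => h; apply/idP/idP => [jh|]; last exact: jmin.
by rewrite (le_trans ej jh) (le_trans fj jh).
Qed.

Definition lat_join e f : lat := projT1 (cid (lat_join_exists e f)).

Lemma lat_joinP e f h : (lat_join e f <= h) = (e <= h) && (f <= h).
Proof. by rewrite /lat_join; case: cid. Qed.

HB.instance Definition _ :=
  Order.POrder_isJoinSemilattice.Build set_display lat lat_joinP.

End Lattice.

Section Elements.
Context {dP : Order.disp_t} {P : tbPOrderType dP} {G : groupType} {K : Type}.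
Variable D : coding P G K.
Local Notation pt := (site P G K).
Local Notation nm := (block_name P G K).
Local Notation L := (lat D).
Implicit Types (k l : K) (g : G) (p q : P) (x y z : pt) (n m : nm) (e f j : L).

Local Notation "x /\m y" := (Order.meet x y) (at level 40).
Local Notation "x \/j y" := (Order.join x y) (at level 45).

Lemma pts_meet e f : pts (e /\m f) = pts e `&` pts f.
Proof. by []. Qed.

Lemma pts_joinl e f : pts e `<=` pts (e \/j f).
Proof. by apply/pts_leP; exact: leUl. Qed.

Lemma pts_joinr e f : pts f `<=` pts (e \/j f).
Proof. by apply/pts_leP; exact: leUr. Qed.

Lemma pts_valid e x : pts e x -> valid D x.
Proof. exact: closed_valid (closed_pts e) x. Qed.

Lemma pts_lower e x : pts e x -> pts e (lower D x).
Proof. exact: closed_lower (closed_pts e) x. Qed.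

Lemma pts_base e x : pts e x -> pts e (base D x).
Proof. by move=> ?; do 2 apply: pts_lower. Qed.

(** The default value serves block names with an improper color. *)
Definition blk n : L :=
  if pselect (closed D (block D n)) is left cn then lat_of cn else lat_top D.

Lemma pts_blk n : ok n -> pts (blk n) = block D n.
Proof.
move=> on; rewrite /blk; case: pselect => // -[].
by constructor 2; exists n.
Qed.

Lemma blk_le n m : ok n -> ok m ->
  (blk n <= blk m) -> n = m \/ nested n m.
Proof.
move=> on om /pts_leP; rewrite !pts_blk //; exact: block_sub.
Qed.

Lemma low_le_up p : proper p -> blk (LowB p) <= blk (UpB p).
Proof.
by move=> op; apply/pts_leP; rewrite !pts_blk //; exact: block_nested.
Qed.

Lemma blk_inj n m : ok n -> ok m -> blk n = blk m -> n = m.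
Proof.
move=> on om e; apply: (@block_inj _ _ _ _ D) => //.
by rewrite -!pts_blk // e.
Qed.

(** The smallest closed set that contains x. *)
Definition chain x : set pt := [set y | [\/ y = x, y = lower D x | y = base D x]].

Lemma small_chain x : valid D x -> small D (chain x).
Proof.
move=> vx; split.
- apply: (sub_finite_set (B := [set x; lower D x; base D x])); last exact: finite_set3.
  by move=> y [->|->|->]; [left; left|left; right|right].
- by move=> y [->|->|->] //; do ?apply: valid_lower.
- move=> y [->|->|->]; [constructor 2|constructor 3|constructor 3] => //.
  exact: lower_lower.
- have chx y : chain x y -> cell D y = cell D x by case=> ->; rewrite /base ?cell_lower.
  by move=> y z /chx -> /chx ->.
Qed.

Definition down x : L :=
  if pselect (closed D (chain x)) is left cx then lat_of cx else lat_top D.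

Lemma pts_down x : valid D x -> pts (down x) = chain x.
Proof.
move=> vx; rewrite /down; case: pselect => // -[].
by constructor 3; exact: small_chain.
Qed.

Lemma pts_down_atomic x : valid D x -> atomic D x -> pts (down x) = [set x].
Proof.
move=> vx ax; rewrite pts_down //; apply/seteqP; split=> y; last by constructor 1.
by rewrite /chain /= /base !ax; case.
Qed.

Lemma down_le x e : valid D x -> (down x <= e) <-> pts e x.
Proof.
move=> vx; split=> [/pts_leP|ex]; first by rewrite pts_down //; apply; constructor 1.
apply/pts_leP; rewrite pts_down // => y [->|->|->] //; first exact: pts_lower.
exact: pts_base.
Qed.

Lemma small_set0 : small D set0.
Proof. by split=> //; exact: finite_set0. Qed.

Definition lat_bot : L := lat_of (closed_small small_set0).

Lemma pts_bot : pts lat_bot = set0.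
Proof. by []. Qed.

Lemma lat_bot_le e : lat_bot <= e.
Proof. by apply/pts_leP. Qed.

Lemma lat_cases e :
  [\/ e = lat_top D, exists2 n, ok n & e = blk n | small D (pts e)].
Proof.
case: (closed_pts e) => [ev|[n on en]|]; last by constructor 3.
- by constructor 1; exact: pts_inj.
- by constructor 2; exists n => //; apply: pts_inj; rewrite pts_blk.
Qed.

Lemma small_le e f : e <= f -> small D (pts f) -> small D (pts e).
Proof.
move=> /pts_leP ef fs; apply: small_sub fs ef _; exact: closed_lower (closed_pts e).
Qed.

Lemma pts_join_small e f :
  small D (pts e `|` pts f) -> pts (e \/j f) = pts e `|` pts f.
Proof.
move=> s; apply/seteqP; split; last first.
  by move=> x [?|?]; [exact: pts_joinl|exact: pts_joinr].
suff /pts_leP : e \/j f <= lat_of (closed_small s) by [].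
by rewrite leUx; apply/andP; split; apply/pts_leP => x ?; [left|right].
Qed.

Lemma far_top e x y : pts e x -> pts e y -> far D x y -> e = lat_top D.
Proof.
move=> ex ey [cxy nxy]; case: (lat_cases e) => // [[n on en]|[_ _ _ s]].
  move: ex ey; rewrite en pts_blk // => -[_ nx] [_ ny].
  by case: (nxy n).
by case: cxy; exact: s.
Qed.

Lemma blk_up_le p e : proper p -> blk (LowB p) <= e -> e <= blk (UpB p) ->
  e = blk (LowB p) \/ e = blk (UpB p).
Proof.
move=> op /[dup] pe /pts_leP; rewrite pts_blk // => pe' eq.
case: (lat_cases e) => [et|[n on en]|es].
- by right; apply: le_anti; rewrite eq et le_lat_top.
- subst e; have [<-|/nestedP [q [<-] ->]] := @blk_le (LowB p) n op on pe; first by left.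
  by right.
- case: (@block_not_small _ _ _ _ D (LowB p) op); apply: small_sub es pe' _.
  exact: lower_closed_block.
Qed.

(** A block has at most one mark and a small set finitely many points. *)
Lemma top_atoms e : (forall x, valid D x -> atomic D x -> pts e x) ->
  e = lat_top D.
Proof.
move=> ae; have Mk k : pts e (Mark k) by exact: ae.
case: (lat_cases e) => // [[n on en]|[fin _ _ _]].
- have [k1 [k2 [_ _ k12]]] := infinite_two (idx_infinite D).
  have [_ n1] : block D n (Mark k1) by rewrite -pts_blk // -en.
  have [_ n2] : block D n (Mark k2) by rewrite -pts_blk // -en.
  by case: k12; move: (inc_Mark n2); rewrite (inc_Mark n1); case.
- have [k0 _] := infinite_setN0 (idx_infinite D).
  by case: (@inj_infinite _ _ _ _ D Mark (pts e) k0 _ _ fin) => [k l []|].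
Qed.

End Elements.

(** * The congruences of the colors *)

Section Congruences.
Context {dP : Order.disp_t} {P : tbPOrderType dP} {G : groupType} {K : Type}.
Variable D : coding P G K.
Local Notation pt := (site P G K).
Local Notation nm := (block_name P G K).
Local Notation L := (lat D).
Implicit Types (k l : K) (g : G) (p q : P) (x y z : pt) (n m : nm) (e f j : L).

Local Notation "x /\m y" := (Order.meet x y) (at level 40).
Local Notation "x \/j y" := (Order.join x y) (at level 45).
Local Notation low p := (blk D (LowB p)).
Local Notation up p := (blk D (UpB p)).

(** The pairs that collapse no minimal point are few. *)
Lemma atoms_below e f : e <= f ->
  (forall x, pts f x -> atomic D x -> pts e x) ->
  [\/ e = f, exists2 p, proper p & e = low p /\ f = up p | small D (pts f)].
Proof.
move=> ef fe; case: (lat_cases f) => [ft|[n on fn]|]; last by constructor 3.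
  constructor 1; rewrite ft; apply: top_atoms => x vx ax; apply: fe => //.
  by rewrite ft.
case: (lat_cases e) => [et|[m om em]|[efin _ _ _]].
- by constructor 1; apply: le_anti; rewrite ef et le_lat_top.
- have [mn|/nestedP [p mp np]] : m = n \/ nested m n.
    by apply: (@blk_le _ _ _ _ D) => //; rewrite -em -fn.
    by constructor 1; rewrite em fn mn.
  by subst; constructor 2; exists p.
- case: (block_atoms_infinite (D := D) on); apply: sub_finite_set efin.
  by move=> x [nx ax]; apply: fe => //; rewrite fn pts_blk.
Qed.

(** The congruence that collapses all points of color at most q. *)
Definition alpha q : set (L * L) :=
  [set ef | forall x, ~~ (color x <= q) -> (pts ef.1 x <-> pts ef.2 x)].

Lemma alpha_low_up p q : proper p -> p <= q -> alpha q (low p, up p).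
Proof.
move=> op pq x Nxq /=; rewrite !pts_blk //.
split=> [|[vx ux]]; first exact: block_nested.
split=> //; apply: contrapT => Nlx; move/negP: Nxq; apply.
by apply: le_trans pq; exact: (color_up (D := D)).
Qed.

Lemma alpha_atomic q e f x : q <> \top -> alpha q (e, f) ->
  pts f x -> atomic D x -> pts e x.
Proof.
move=> qt ef fx ax; apply/ef => //; rewrite (color_atomic ax).
by apply/negP; rewrite le1x => /eqP.
Qed.

(** By [atoms_below] either e and f are the two blocks of some p, and then the
    join with j is a block of p or the top, or f is small.  In the latter case
    e contains the base of the chain in which f lies.  If the join e \/ j is
    not small, it is the top or a block, and as soon as it contains the base,
    the upper block over it contains f.  The only possible difference between
    the two joins is therefore between the blocks of some p, and [color_low]
    shows that then p <= q. *)
Lemma alpha_join q e f j : e <= f -> alpha q (e, f) ->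
  alpha q (e \/j j, f \/j j).
Proof.
move=> ef aef.
have [qt|qt] := pselect (q = \top); first by move=> x; rewrite qt lex1.
have EF : e \/j j <= f \/j j by rewrite leU2.
have [E1|NE1] := pselect (e \/j j = lat_top D).
  suff -> : f \/j j = lat_top D by rewrite E1.
  by apply: le_anti; rewrite le_lat_top -E1 EF.
case: (atoms_below ef (fun x fx => alpha_atomic qt aef fx)) => [->//|[p op [ep fp]]|fs].
  (* e and f are the two blocks of p *)
  have [Eup|NEup] := pselect (e \/j j <= up p).
    have -> : f \/j j = up p.
      apply: le_anti; rewrite leUx fp lexx leUl !andbT.
      exact: le_trans (leUr _ _) Eup.
    have pE : low p <= e \/j j by rewrite -ep leUl.
    by have [->|->] := blk_up_le op pE Eup; first by rewrite -ep -fp.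
  case: (lat_cases (e \/j j)) => // [[n on En]|Es].
    case: NEup; rewrite En.
    have [<-|/nestedP [p' [<-] ->]//] : LowB p = n \/ nested (LowB p) n.
        by apply: (@blk_le _ _ _ _ D) => //; rewrite -En ep leUl.
      exact: low_le_up.
  have := small_le (leUl e j) Es; rewrite ep pts_blk //.
  by move/block_not_small => /(_ op).
have [->//|Nef] := pselect (e = f).
(* f is small, so it lies in the chain of any point x0 of f outside e, and e
   contains the base of this chain *)
have [x0 fx0 Nex0] : exists2 x, pts f x & ~ pts e x.
  apply: contrapT => N; apply: Nef; apply: le_anti; rewrite ef /=.
  by apply/pts_leP => x fx; apply: contrapT => ex; apply: N; exists x.
have x0n : lower D x0 <> x0.
  by move=> ax; apply: Nex0; exact: alpha_atomic aef fx0 ax.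
have bx0 : pts e (base D x0).
  by apply: (alpha_atomic qt aef); [exact: pts_base|exact: base_atomic].
have [fjs|Nfjs] := pselect (small D (pts f `|` pts j)).
  have ejs : small D (pts e `|` pts j).
    apply: small_sub fjs _ _; first by apply: setSU; exact/pts_leP.
    by move=> x [?|?]; [left|right]; exact: pts_lower.
  move=> x Nx; rewrite /= !pts_join_small //.
  by have /= := aef x Nx; split; move=> [?|?]; [left|right|left|right]; intuition.
(* if the join of e and j were small, f and j would lie in one cell *)
case: (lat_cases (e \/j j)) => // [[n on En]|Es]; last first.
  case: Nfjs; have [jfin jv jp jc] := small_le (leUr j e) Es.
  case: (fs) => ffin fv fp fc; split.
  - by rewrite finite_setU.
  - by move=> x [/fv|/jv].
  - by move=> x [/fp|/jp] ?; [left|right].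
  - have fjc x : (pts f `|` pts j) x -> cell D x = cell D x0.
      case=> [fx|jx]; first exact: fc.
      have -> : cell D x0 = cell D (base D x0) by rewrite /base !cell_lower.
      case: Es => _ _ _; apply; first exact: pts_joinr.
      exact: pts_joinl.
    by move=> x y /fjc -> /fjc ->.
have Fup : f \/j j <= blk D (up_name n).
  have nup : blk D n <= blk D (up_name n).
    by case: n on {En} => //= p op; exact: low_le_up.
  rewrite leUx; apply/andP; split; last first.
    by apply: le_trans nup; rewrite -En leUr.
  apply/pts_leP => x fx; rewrite pts_blk; last exact: ok_up.
  split; first exact: pts_valid fx.
  apply: (@inc_base_up _ _ _ _ D).
  have -> : base D x = base D x0.
    by apply: nonatomic_base => //; case: fs => _ _ _; apply.
  have : pts (e \/j j) (base D x0) by apply: pts_joinl.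
  by rewrite En pts_blk // => -[].
have [upn|Nupn] := pselect (up_name n = n).
  suff -> : f \/j j = e \/j j by [].
  by apply: le_anti; rewrite EF andbT En -[X in blk _ X]upn Fup.
have [p np] : exists p, n = LowB p by case: n Nupn {on En Fup} => //= p; exists p.
(* now the two joins can only differ by being the two blocks of p *)
subst n; rewrite /= in Fup.
have lF : low p <= f \/j j by rewrite -En EF.
have [FE|FE] := blk_up_le on lF Fup; first by rewrite FE En.
 rewrite FE En; apply: alpha_low_up => //.
have Nfl : ~ (f <= low p).
  move=> fl; have : up p <= low p.
    by rewrite -FE leUx fl -En leUr.
  by move/(@blk_le _ _ _ _ D (UpB p) (LowB p) on on) => [].
have [y fy Nly] : exists2 y, pts f y & ~ inc D (LowB p) y.
  apply: contrapT => N; apply: Nfl; apply/pts_leP => y fy; rewrite pts_blk //.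
  split; first exact: pts_valid fy.
  by apply: contrapT => Ny; apply: N; exists y.
have by_ : inc D (LowB p) (base D y).
  have -> : base D y = base D x0.
    by apply: nonatomic_base => //; case: fs => _ _ _; apply.
  have : pts (e \/j j) (base D x0) by apply: pts_joinl.
  by rewrite En pts_blk // => -[].
have [z fz [Nlz pz]] := color_low (@pts_lower _ _ _ _ D f) (@pts_valid _ _ _ _ D f) fy by_ Nly.
apply: le_trans pz _; apply/negPn/negP => Nzq.
have : pts e z by apply/(aef z Nzq).
by move=> /(@pts_joinl _ _ _ _ D e j); rewrite En pts_blk // => -[].
Qed.

Lemma alpha_congruence q : is_congruence (alpha q).
Proof.
apply: is_congruence_le.
- by [].
- by move=> e f ef x Nx; apply: iff_sym; exact: ef.
- by move=> e f j ef fj x Nx; apply: iff_trans (ef x Nx) (fj x Nx).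
- move=> e f j ef x Nx /=; have [ex fx] : pts e x <-> pts f x := ef x Nx.
  by split=> -[H jx]; split=> //; [exact: ex|exact: fx].
- by move=> e f j; exact: alpha_join.
Qed.

End Congruences.

(** * Generation of congruences *)

Section Generation.
Context {dP : Order.disp_t} {P : tbPOrderType dP} {G : groupType} {K : Type}.
Variable D : coding P G K.
Local Notation pt := (site P G K).
Local Notation nm := (block_name P G K).
Local Notation L := (lat D).
Implicit Types (k l : K) (g : G) (p q : P) (x y z : pt) (n m : nm) (e f j : L).

Local Notation "x /\m y" := (Order.meet x y) (at level 40).
Local Notation "x \/j y" := (Order.join x y) (at level 45).
Local Notation low p := (blk D (LowB p)).
Local Notation up p := (blk D (UpB p)).

Lemma down_meet_chain e x : valid D x -> pts e (lower D x) -> ~ pts e x ->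
  e /\m down D x = down D (lower D x).
Proof.
move=> vx epx Nex; apply: pts_inj; rewrite pts_meet !pts_down //; last exact: valid_lower.
apply/seteqP; split=> y.
  by case=> ey [yx|->|->]; [rewrite yx in ey|constructor 1|constructor 2].
have eb : pts e (base D x) by exact: pts_lower.
case=> ->; split=> //; first by constructor 2.
- by constructor 3.
- by rewrite /base lower_lower.
- by rewrite /base lower_lower; constructor 3.
Qed.

(** In the gadget of a < b, the middle point has the larger color b. *)
Lemma max_color (A : set pt) x0 : A x0 ->
  (forall x, A x -> [/\ valid D x, lower D x <> x & cell D x = cell D x0]) ->
  exists2 x, A x & forall y, A y -> color y <= color x.
Proof.
case: x0 => [k|k l|k l|g k|g k|p k|p|a b|a b|a b] A0 A1;
  try (by case: (A1 _ A0) => _ /= []).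
- exists (ColTop p) => // y /A1 [_ + /=].
  by case: y => //= q _ [] ->.
- exists (GadMid a b) => // y /A1 [+ + /=].
  case: y => //= [c d _ _ [_ ->]//|c d [_ [_ cd]] _ [ca db]].
  by rewrite -db; exact: ltW.
- have [Am|NAm] := pselect (A (GadMid a b)).
    exists (GadMid a b) => // y /A1 [+ + /=].
    case: y => //= [c d _ _ [_ ->]//|c d [_ [_ cd]] _ [ca db]].
    by rewrite -db; exact: ltW.
  exists (GadTop a b) => // y /[dup] Ay /A1 [+ + /=].
  case: y Ay => //= [c d Acd _ _ [ca db]|c d _ _ _ [-> _]//].
  by case: NAm; rewrite -ca -db.
Qed.

Lemma small_down f x0 : small D (pts f) -> pts f x0 -> lower D x0 <> x0 ->
  exists2 y, pts f y & f = down D y.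
Proof.
move=> [_ fv fp fc] fx0 nx0.
suff [y fy fcy] : exists2 y, pts f y & pts f `<=` chain D y.
  exists y => //; apply: pts_inj; rewrite pts_down; last exact: fv.
  apply/seteqP; split=> // z; case=> ->//; first exact: fp.
  exact/fp/fp.
case: x0 fx0 nx0 => [k|k l|k l|g k|g k|p k|p|a b|a b|a b] fx0 // _.
- exists (ColTop p) => // y /(fc _ _ fx0) /=.
  by case: y => //= [q k [<- <-]|q [<- _]]; [constructor 2|constructor 1].
- have [ft|Nft] := pselect (pts f (GadTop a b)).
    exists (GadTop a b) => // y /(fc _ _ fx0) /=.
    case: y => //= c d [<- <-]; [constructor 3|constructor 2|constructor 1]; done.
  exists (GadMid a b) => // y /[dup] fy /(fc _ _ fx0) /=.
  case: y fy => //= c d fy [e1 e2]; subst; [constructor 2|constructor 1|]; done.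
- exists (GadTop a b) => // y /(fc _ _ fx0) /=.
  by case: y => //= c d [<- <-]; [constructor 3|constructor 2|constructor 1].
Qed.

Section Theta.
Variables (theta : set (L * L)) (cth : is_congruence theta).

(** Collapsing the minimal point x to the bottom identifies every point far from
    x with the top, and two such points meet in the bottom. *)
Lemma congruence_total e f x : theta (e, f) -> pts f x -> ~ pts e x ->
  atomic D x -> theta = setT.
Proof.
move=> ef fx Nex ax; have vx := pts_valid fx.
have bx : theta (lat_bot D, down D x).
  have := congruence_meetr cth (down D x) ef.
  have -> : e /\m down D x = lat_bot D.
    apply: pts_inj; rewrite pts_meet pts_down_atomic //.
    by apply/seteqP; split=> // y [ey] /= yx; case: Nex; rewrite -yx.
  by rewrite meet_r //; exact/down_le.
have yt y : valid D y -> far D x y -> theta (down D y, lat_top D).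
  move=> vy xy; have := congruence_joinr cth (down D y) bx.
  rewrite join_r ?lat_bot_le //.
  have -> // : down D x \/j down D y = lat_top D.
  apply: (far_top _ _ xy).
    by apply/(down_le _ vx); exact: leUl.
  by apply/(down_le _ vy); exact: leUr.
have [y [z [[vy ay] [vz az] yz xy xz]]] := far_atoms vx.
have bt : theta (lat_bot D, lat_top D).
  have := congruence_meet cth (yt y vy xy) (yt z vz xz).
  have -> : down D y /\m down D z = lat_bot D.
    apply: pts_inj; rewrite pts_meet !pts_down_atomic //.
    by apply/seteqP; split=> // w [/= -> /yz].
  by rewrite meetxx.
have ba a : theta (lat_bot D, a).
  have := congruence_meetr cth a bt.
  by rewrite (meet_l (lat_bot_le a)) (meet_r (le_lat_top a)).
apply/seteqP; split=> // -[a b] _.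
exact: (congruence_trans cth (congruence_sym cth (ba a)) (ba b)).
Qed.

(** Meet with the chain of x, then join with the lower block of the color of
    x. *)
Lemma congruence_color e f x : theta (e, f) -> pts f x -> ~ pts e x ->
  lower D x <> x -> theta (low (color x), up (color x)).
Proof.
move=> ef fx Nex nx; have vx := pts_valid fx.
have [op lpx ux Nlx] := color_nonatomic vx nx.
set p := color x in op lpx ux Nlx *.
have := congruence_joinr cth (low p) (congruence_meetr cth (down D x) ef).
have vpx := valid_lower vx.
have lx : down D x <= up p by apply/down_le => //; rewrite pts_blk.
have -> : (e /\m down D x) \/j low p = low p.
  apply: join_r; apply/pts_leP => y [ey].
  rewrite -/(pts (down D x)) pts_down // pts_blk // => -[yx|->|->].
  - by rewrite yx in ey.
  - by [].
  - by split; [exact: valid_lower|exact: inc_lower].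
have -> // : (f /\m down D x) \/j low p = up p.
rewrite (@meet_r _ _ f); last exact/down_le.
have lj : low p <= down D x \/j low p by exact: leUr.
have ju : down D x \/j low p <= up p by rewrite leUx lx low_le_up.
have [jl|//] := blk_up_le op lj ju.
have : pts (down D x \/j low p) x by apply/(down_le _ vx); exact: leUl.
by rewrite jl pts_blk // => -[].
Qed.

Variable q : P.
Hypotheses (oq : proper q) (qth : theta (low q, up q)).

(** For p < q the collapse passes through the gadget of p < q: below the
    lower block of q lies only its bottom. *)
Lemma congruence_low_up p : proper p -> p <= q -> theta (low p, up p).
Proof.
move=> op; rewrite le_eqVlt => /predU1P [->//|pq].
have v : valid D (GadTop p q) by [].
have := congruence_meetr cth (down D (GadTop p q)) qth.
move/(@congruence_color _ _ (GadTop p q)); apply=> //.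
- rewrite pts_meet pts_down // pts_blk //; split; first by split=> //; right.
  by constructor 1.
- rewrite pts_meet pts_blk // => -[[_ /= ]].
  by [].
Qed.

(** The small case: every point y of f outside e has a color at most q, so the
    collapse of its two blocks, met with the chain of y, identifies the chain
    of y with that of the point below y.  Two such steps lead from e to f,
    since f is itself a chain. *)
Lemma alpha_sub_le e f : e <= f -> alpha q (e, f) -> theta (e, f).
Proof.
move=> ef aef; have qt : q <> \top by case: oq.
case: (atoms_below ef (fun x fx => alpha_atomic qt aef fx)) => [<-|[p op [ep fp]]|fs].
- exact: congruence_refl.
- rewrite ep fp; apply: congruence_low_up => //; apply/negPn/negP => Npq.
  have [_ H] := aef (ColTop p) Npq; move: H; rewrite /= ep fp !pts_blk //.
  by move=> H; have [] : block D (LowB p) (ColTop p) by apply: H.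
have [->|Nef] := pselect (e = f); first exact: congruence_refl.
have [x0 fx0 Nex0] : exists2 x, pts f x & ~ pts e x.
  apply: contrapT => N; apply: Nef; apply: le_anti; rewrite ef /=.
  by apply/pts_leP => x fx; apply: contrapT => ex; apply: N; exists x.
have nx0 : lower D x0 <> x0.
  by move=> ax; apply: Nex0; exact: alpha_atomic aef fx0 ax.
have step y : pts f y -> theta (e \/j down D (lower D y), e \/j down D y).
  move=> fy; have vy := pts_valid fy; have vpy := valid_lower vy.
  have [ey|Ney] := pselect (pts e y).
    rewrite !join_l; first exact: congruence_refl.
      by apply/down_le.
    by apply/(down_le _ vpy); exact: pts_lower.
  have ny : lower D y <> y by move=> ay; apply: Ney; exact: alpha_atomic aef fy ay.
  have [op lpy uy Nly] := color_nonatomic vy ny.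
  have cq : color y <= q.
    by apply/negPn/negP => Nc; apply: Ney; apply/(aef y Nc).
  have := congruence_meetr cth (down D y) (congruence_low_up op cq).
  rewrite down_meet_chain ?pts_blk //; last by case.
  rewrite meet_r; last by apply/down_le => //; rewrite pts_blk.
  by move=> /(congruence_joinr cth e); rewrite !(joinC _ e).
have [y fy fE] := small_down fs fx0 nx0.
have := congruence_trans cth (step _ (pts_lower fy)) (step y fy).
rewrite -fE (join_r ef) join_l //; apply/down_le.
  exact/valid_lower/valid_lower/pts_valid/fy.
by apply: alpha_atomic aef _ _ => //; [exact/pts_lower/pts_lower|exact: base_atomic].
Qed.

Lemma alpha_sub : alpha q `<=` theta.
Proof.
move=> [e f] aef; apply/(congruence_meet_join cth); apply: alpha_sub_le.
  exact: le_trans (leIl _ _) (leUl _ _).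
by have [H _] := congruence_meet_join (alpha_congruence D q) e f; exact: H.
Qed.

End Theta.

Lemma alpha_top : alpha \top = setT :> set (L * L).
Proof. by apply/seteqP; split=> // ef _ x; rewrite lex1. Qed.

(** The largest color of a collapsed point decides the congruence. *)
Lemma con_color e f : e <= f -> e <> f ->
  exists x, [/\ pts f x, ~ pts e x & con e f = alpha (color x)].
Proof.
move=> ef Nef; have cth := is_congruence_con e f; have efc : con e f (e, f) by exact: con_gen.
have [[x [fx Nex ax]]|Na] := pselect (exists x, [/\ pts f x, ~ pts e x & atomic D x]).
  exists x; split=> //; rewrite (color_atomic ax) alpha_top.
  exact: congruence_total efc fx Nex ax.
have fe x : pts f x -> atomic D x -> pts e x.
  by move=> fx ax; apply: contrapT => Nex; apply: Na; exists x.
suff [x [fx Nex xmax]] : exists x, [/\ pts f x, ~ pts e x &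
    forall y, pts f y -> ~ pts e y -> color y <= color x].
  have nx : lower D x <> x by move=> ax; apply: Nex; exact: fe.
  exists x; split=> //; apply/seteqP; split.
    apply: con_sub; first exact: alpha_congruence.
    move=> y Ny /=; split; first by move: y {Ny}; exact/pts_leP.
    move=> fy; apply: contrapT => Ney; move/negP: Ny; apply; exact: xmax.
  have [ox _ _ _] := color_nonatomic (pts_valid fx) nx.
  apply: alpha_sub => //; exact: congruence_color efc fx Nex nx.
case: (atoms_below ef fe) => [//|[p op [ep fp]]|fs].
  exists (ColTop p); rewrite ep fp !pts_blk //; split=> //; first by case.
  move=> y [vy uy] Nly; apply: (color_up (D := D)) => // ly; exact: Nly.
have [x0 fx0 Nex0] : exists2 x, pts f x & ~ pts e x.
  apply: contrapT => N; apply: Nef; apply: le_anti; rewrite ef /=.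
  by apply/pts_leP => x fx; apply: contrapT => ex; apply: N; exists x.
have [|x [fx Nex] xmax] := @max_color [set x | pts f x /\ ~ pts e x] x0 (conj fx0 Nex0).
  move=> x [fx Nex]; split; first exact: pts_valid fx.
    by move=> ax; apply: Nex; exact: fe.
  by case: fs => _ _ _; apply.
by exists x; split=> // y fy Ney; exact: xmax.
Qed.

End Generation.

(** * Principal congruences *)

Section Principal.
Context {dP : Order.disp_t} {P : tbPOrderType dP} {G : groupType} {K : Type}.
Variable D : coding P G K.
Local Notation L := (lat D).
Implicit Types (p q : P) (e f : L).
Local Notation low p := (blk D (LowB p)).
Local Notation up p := (blk D (UpB p)).

Lemma prime_low_up p : proper p -> prime_interval (low p) (up p).
Proof.
move=> op; split.
  rewrite lt_neqAle low_le_up // andbT; apply/eqP => /blk_inj.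
  by move=> /(_ op op).
apply/seteqP; split=> e /=; first by case/andP=> le eu; exact: blk_up_le.
by case=> ->; rewrite lexx low_le_up.
Qed.

Lemma con_low_up p : proper p -> con (low p) (up p) = alpha p.
Proof.
move=> op; apply/seteqP; split.
  by apply: con_sub; [exact: alpha_congruence|exact: alpha_low_up].
apply: alpha_sub => //; [exact: is_congruence_con|exact: con_gen].
Qed.

Lemma prime_Mark k : prime_interval (lat_bot D) (down D (Mark k)).
Proof.
have ptsM : pts (down D (Mark k)) = [set Mark k] by rewrite pts_down_atomic.
split.
  rewrite lt_neqAle lat_bot_le andbT; apply/eqP => /(congr1 (@pts _ _ _ _ _)).
  by rewrite ptsM pts_bot => /esym; apply/eqP/set0P; exists (Mark k).
apply/seteqP; split=> e /=; last first.
  by case=> ->; rewrite ?lexx ?lat_bot_le.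
case/andP=> _ /pts_leP; rewrite ptsM => eM.
have [ek|Nek] := pselect (pts e (Mark k)); [right|left]; apply: pts_inj.
  by rewrite ptsM; apply/seteqP; split=> // _ ->.
by apply/seteqP; split=> // x /[dup] ex /eM xk; case: Nek; rewrite -xk.
Qed.

Lemma con_Mark k : con (lat_bot D) (down D (Mark k)) = setT.
Proof.
apply: (@congruence_total _ _ _ _ _ _ _ (lat_bot D) (down D (Mark k)) (Mark k)) => //.
- exact: is_congruence_con.
- exact: con_gen.
- by rewrite pts_down_atomic.
Qed.

Lemma alpha_bot : alpha \bot = diagonal :> set (L * L).
Proof.
apply/seteqP; split=> -[e f]; last first.
  by move=> /diagonalP -> x.
have H (a b : L) : alpha \bot (a, b) -> pts a `<=` pts b.
  move=> ab x ax; apply/(ab x) => //.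
  by rewrite lex0; apply/eqP/(color_neq_bot (D := D))/(pts_valid ax).
move=> ef; apply/diagonalP/le_anti; apply/andP; split; apply/pts_leP.
  exact: H.
by apply: H => x Nx; apply: iff_sym; exact: ef.
Qed.

Lemma principal_alpha (theta : set (L * L)) : is_principal theta ->
  exists p, theta = alpha p.
Proof.
move=> [a [b ->]]; rewrite con_meet_join.
have le : Order.meet a b <= Order.join a b by exact: le_trans (leIl _ _) (leUl _ _).
have [e|ne] := pselect (Order.meet a b = Order.join a b).
  by exists \bot; rewrite e con_refl alpha_bot.
by have [x [_ _ ->]] := con_color le ne; exists (color x).
Qed.

Lemma alpha_prime p : p <> \bot -> exists a b : L,
  prime_interval a b /\ alpha p = con a b.
Proof.
move=> pb; have [k0 _] := infinite_setN0 (idx_infinite D).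
have [->|pt] := pselect (p = \top).
  exists (lat_bot D), (down D (Mark k0)); split; first exact: prime_Mark.
  by rewrite con_Mark alpha_top.
by exists (low p), (up p); split; [exact: prime_low_up|rewrite con_low_up].
Qed.

Lemma alpha_principal p : is_principal (alpha p : set (L * L)).
Proof.
have [->|pb] := pselect (p = \bot).
  by exists (lat_bot D), (lat_bot D); rewrite con_refl alpha_bot.
by have [a [b [_ e]]] := alpha_prime pb; exists a, b.
Qed.

Lemma alpha_subset p q : (alpha p `<=` (alpha q : set (L * L))) <-> p <= q.
Proof.
split=> [pq|pq]; last first.
  move=> ef ep x Nx; apply: ep; apply: contra Nx => xp; exact: le_trans pq.
have [->|pb] := pselect (p = \bot); first exact: le0x.
have [k0 _] := infinite_setN0 (idx_infinite D).
have [pt|pt] := pselect (p = \top).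
  move: pq; rewrite pt alpha_top => /(_ (lat_bot D, down D (Mark k0)) I) H.
  apply/negPn/negP => Nq; have [_] := H (Mark k0) Nq.
  by rewrite /= pts_down_atomic // => /(_ erefl).
have op : proper p by [].
have := pq _ (alpha_low_up D op (lexx p)).
move=> /(_ (ColTop p)) H; apply/negPn/negP => Nq.
have [_] := H Nq; rewrite /= !pts_blk // => /(_ _)[] //; exact: conj.
Qed.

Theorem Princ_isomorphic : order_isomorphic (Princ L) P.
Proof.
pose g p : Princ L := exist _ (alpha p) (mem_set (alpha_principal p)).
have gmono : {mono g : p q / p <= q}.
  move=> p q; rewrite leEsub; apply/idP/idP; rewrite subsetEset; last exact: (alpha_subset p q).2.
  exact: (alpha_subset p q).1.
have gsurj (t : Princ L) : exists p, g p = t.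
  have [p e] := principal_alpha (set_mem (valP t)).
  by exists p; apply: val_inj.
have /choice [f fK] := gsurj.
have gK : cancel g f by move=> p; apply: le_anti; rewrite -!gmono fK lexx.
exists f; split; first by exists g.
by move=> s t; rewrite -gmono !fK.
Qed.

Theorem principal_prime (theta : set (L * L)) :
  is_principal theta -> theta <> diagonal ->
  exists a b : L, prime_interval a b /\ theta = con a b.
Proof.
move=> /principal_alpha [p ->] Nd; apply: alpha_prime => pb.
by apply: Nd; rewrite pb alpha_bot.
Qed.

End Principal.

(** * Elements, filters and ideals counted *)

Section Cardinals.
Context {dP : Order.disp_t} {P : tbPOrderType dP} {G : groupType} {K : Type}.
Variable D : coding P G K.
Local Notation L := (lat D).
Local Notation pt := (site P G K).
Local Notation nm := (block_name P G K).

(** Finite words over the index set code everything in sight, with the first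
    letter as a tag. *)
Lemma coding_maps : exists (c : seq K -> K) (nu : nat -> K) (jG : G -> K),
  [/\ injective c, injective nu & injective jG].
Proof.
have [c cinj] := seq_coding (idx_infinite D).
have [nu nuinj _] := infinite_nat_inj (idx_infinite D).
have [jG jGK] := choice (label_surj D).
by exists c, nu, jG; split => //; exact: can_inj jGK.
Qed.

Lemma site_coding : exists f : pt -> K, injective f.
Proof.
have [c [nu [jG [c_inj nu_inj jG_inj]]]] := coding_maps.
have jP_inj := anchor_inj (c := D).
exists (fun x => c match x with
  | Mark k => [:: nu 0; k]
  | OrdLow k l => [:: nu 1; k; l]
  | OrdHigh k l => [:: nu 2; k; l]
  | ActSrc g k => [:: nu 3; jG g; k]
  | ActTgt g k => [:: nu 4; jG g; k]
  | ColPt p k => [:: nu 5; anchor D p; k]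
  | ColTop p => [:: nu 6; anchor D p]
  | GadBot p q => [:: nu 7; anchor D p; anchor D q]
  | GadMid p q => [:: nu 8; anchor D p; anchor D q]
  | GadTop p q => [:: nu 9; anchor D p; anchor D q]
  end%N).
move=> x y /c_inj.
case: x => [?|? ?|? ?|? ?|? ?|? ?|?|? ?|? ?|? ?];
  case: y => [?|? ?|? ?|? ?|? ?|? ?|?|? ?|? ?|? ?] [];
  try (by move=> /nu_inj); by do ?[move=> /jG_inj ->|move=> /jP_inj ->|move=> ->].
Qed.

Lemma block_coding : exists f : nm -> K, injective f.
Proof.
have [c [nu [jG [c_inj nu_inj jG_inj]]]] := coding_maps.
have jP_inj := anchor_inj (c := D).
exists (fun n => c match n with
  | OrdB k => [:: nu 0; k]
  | GrpB g => [:: nu 1; jG g]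
  | LowB p => [:: nu 2; anchor D p]
  | UpB p => [:: nu 3; anchor D p]
  end%N).
move=> n m /c_inj; case: n => [?|?|?|?]; case: m => [?|?|?|?] [];
  try (by move=> /nu_inj); by do ?[move=> /jG_inj ->|move=> /jP_inj ->|move=> ->].
Qed.

Lemma lat_coding : exists f : L -> K, injective f.
Proof.
have [c [nu [_ [c_inj nu_inj _]]]] := coding_maps.
have [cs cs_inj] := site_coding; have [cb cb_inj] := block_coding.
pose dec (t : option (nm + seq pt)) : set pt :=
  match t with
  | None => valid D
  | Some (inl n) => block D n
  | Some (inr s) => listed s
  end.
have /choice [t tP] (e : L) : exists t, pts e = dec t.
  case: (closed_pts e) => [->|[n _ ->]|[/finite_listed [s ->] _ _ _]].
  - by exists None.
  - by exists (Some (inl n)).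
  - by exists (Some (inr s)).
pose enc (t : option (nm + seq pt)) : seq K :=
  match t with
  | None => [::]
  | Some (inl n) => [:: cb n]
  | Some (inr s) => nu 0%N :: nu 0%N :: map cs s
  end.
have enc_inj : injective enc.
  move=> [[n|s]|] [[m|s']|] //=; first by case=> /cb_inj ->.
  by case=> /(inj_map cs_inj) ->.
exists (c \o enc \o t) => e f /= /c_inj /enc_inj tt.
by apply: pts_inj; rewrite !tP tt.
Qed.

Lemma card_lat : [set: L] #= [set: K].
Proof.
have [f f_inj] := lat_coding.
apply: Cantor_Bernstein; first exact: injective_card_le f_inj.
apply: (@injective_card_le _ _ (fun k => down D (Mark k))) => k l.
move=> /(congr1 (fun e : L => pts e (Mark k))); rewrite !pts_down_atomic //=.
by move=> e; have : Mark k = Mark l :> pt by [rewrite -e]; case.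
Qed.

Lemma card_Filt_lat : Filt L #= [set: K].
Proof. by apply: card_eq_trans card_lat; apply: card_Filt_wf; exact: lat_wf. Qed.

Definition mark_ideal (S : set K) : set L :=
  [set e | small D (pts e) /\ pts e `<=` Mark @` S].

Lemma mark_idealP S : is_ideal (mark_ideal S).
Proof.
split.
- by exists (lat_bot D); split; [exact: small_set0|move=> x []].
- move=> e f [fs fS] ef; split; first exact: small_le fs.
  by apply: subset_trans fS; exact/pts_leP.
- move=> e f [[efin ev ep _] eS] [[ffin fv fp _] fS].
  have efS : pts e `|` pts f `<=` Mark @` S by move=> x [/eS|/fS].
  have s : small D (pts e `|` pts f).
    split.
    + by rewrite finite_setU.
    + by move=> x [/ev|/fv].
    + by move=> x [/ep|/fp] ?; [left|right].
    + by move=> x y /efS [k _ <-] /efS [l _ <-].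
  by rewrite /mark_ideal /= pts_join_small.
Qed.

Lemma mark_ideal_inj : injective mark_ideal.
Proof.
have mem S k : mark_ideal S (down D (Mark k)) <-> S k.
  rewrite /mark_ideal /= pts_down_atomic //; split.
    by move=> [_ /(_ _ erefl) [l Sl [<-]]].
  move=> Sk; split; last by move=> _ ->; exists k.
  split; [exact: finite_set1|by move=> _ ->|by move=> _ ->|by move=> _ _ -> ->].
move=> S T e; apply/seteqP; split=> k /mem; [rewrite e|rewrite -e]; by move/mem.
Qed.

Lemma card_Id_lat : Id L #= [set: set K].
Proof.
apply: Cantor_Bernstein; last first.
  by apply: (injective_range_card_le mark_ideal_inj); exact: mark_idealP.
have [f f_inj] := lat_coding.
apply: card_le_trans (subset_card_le (@subsetT _ _)) _.
apply: (@injective_card_le _ _ (fun A : set L => f @` A)) => A B.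
by move=> AB; apply/funext => e; rewrite -(image_inj f_inj) AB image_inj.
Qed.

Lemma Filt_lt_Id : Filt L #<= Id L /\ ~ (Id L #<= Filt L).
Proof.
have FK := card_Filt_lat; have IK := card_Id_lat.
rewrite (card_le_eql FK) (card_le_eqr IK); split.
  apply: (@injective_card_le _ _ (fun k => [set k])) => k l e.
  by have : [set l] k by rewrite -e.
rewrite (card_le_eql IK) (card_le_eqr FK); exact: cantor.
Qed.

End Cardinals.

(** * The group acts on the lattice *)

Section Action.
Context {dP : Order.disp_t} {P : tbPOrderType dP} {G : groupType} {K : Type}.
Variable D : coding P G K.
Local Notation L := (lat D).
Local Notation pt := (site P G K).
Local Notation nm := (block_name P G K).
Implicit Types (a b : G) (x y : pt) (n : nm) (e : L).

(** Left translation of the group parameters; it respects the incidence of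
    [ActTgt], which involves right multiplication by labels. *)
Definition site_act a x : pt :=
  match x with
  | ActSrc g k => ActSrc (a * g)%g k
  | ActTgt g k => ActTgt (a * g)%g k
  | _ => x
  end.

Definition block_act a n : nm := if n is GrpB g then GrpB (a * g)%g else n.

Lemma site_act1 x : site_act 1%g x = x.
Proof. by case: x => //= g k; rewrite mul1g. Qed.

Lemma site_actM a b x : site_act (a * b)%g x = site_act a (site_act b x).
Proof. by case: x => //= g k; rewrite mulgA. Qed.

Lemma site_actVK a : cancel (site_act a^-1%g) (site_act a).
Proof. by move=> x; rewrite -site_actM mulgV site_act1. Qed.

Lemma valid_act a x : valid D (site_act a x) = valid D x.
Proof. by case: x. Qed.

Lemma lower_act a x : lower D (site_act a x) = site_act a (lower D x).
Proof. by case: x. Qed.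

Lemma cell_act a x y : cell D x = cell D y ->
  cell D (site_act a x) = cell D (site_act a y).
Proof. by case: x y => [?|? ?|? ?|? ?|? ?|? ?|?|? ?|? ?|? ?] [] //= *; congruence. Qed.

Lemma inc_act a n x : inc D n x -> inc D (block_act a n) (site_act a x).
Proof. by case: n x => [?|?|?|?] [] //= *; subst; rewrite ?mulgA. Qed.

Lemma block_actK a : cancel (block_act a) (block_act a^-1%g).
Proof. by case=> //= g; rewrite mulKg. Qed.

Lemma ok_act a n : ok (block_act a n) = ok n.
Proof. by case: n. Qed.

Definition act_set a (A : set pt) : set pt := [set x | A (site_act a^-1%g x)].

Lemma act_set_block a n : act_set a (block D n) = block D (block_act a n).
Proof.
apply/seteqP; split=> x [vx nx]; split.
- by rewrite -(valid_act a^-1%g).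
- by rewrite -(site_actVK a x); exact: inc_act.
- by rewrite valid_act.
- by rewrite -(block_actK a n); exact: inc_act.
Qed.

Lemma closed_act a A : closed D A -> closed D (act_set a A).
Proof.
case=> [->|[n on ->]|[fin Av Ap Ac]].
- by constructor 1; apply/seteqP; split=> x; rewrite /act_set /= valid_act.
- by constructor 2; exists (block_act a n); rewrite ?ok_act // act_set_block.
- constructor 3; split.
  + apply: (sub_finite_set (B := site_act a @` A)); last exact: finite_image.
    by move=> x Ax; exists (site_act a^-1%g x) => //; exact: site_actVK.
  + by move=> x /Av; rewrite valid_act.
  + by move=> x Ax; rewrite /act_set /= -lower_act; exact: Ap.
  + move=> x y Ax Ay; rewrite -(site_actVK a x) -(site_actVK a y).
    by apply: cell_act; exact: Ac.
Qed.

Definition act a e : L := lat_of (closed_act a (closed_pts e)).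

Lemma pts_act a e : pts (act a e) = act_set a (pts e).
Proof. by []. Qed.

Lemma actM a b e : act (a * b)%g e = act a (act b e).
Proof.
apply: pts_inj; rewrite !pts_act /act_set; apply/funext => x /=.
by rewrite invgM site_actM.
Qed.

Lemma act1 e : act 1%g e = e.
Proof.
apply: pts_inj; rewrite !pts_act /act_set; apply/funext => x /=.
by rewrite invg1 site_act1.
Qed.

Lemma act_blk a n : ok n -> act a (blk D n) = blk D (block_act a n).
Proof.
move=> on; apply: pts_inj; rewrite pts_act !pts_blk ?ok_act //.
exact: act_set_block.
Qed.

Lemma act_automorphism a : is_lattice_automorphism (act a).
Proof.
apply: order_automorphism.
  exists (act a^-1%g) => e; first by rewrite -actM mulVg act1.
  by rewrite -actM mulgV act1.
have mono b e f : e <= f -> act b e <= act b f.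
  by move=> /pts_leP ef; apply/pts_leP => x; exact: ef.
move=> e f; apply/idP/idP; last exact: mono.
by move=> /(mono a^-1%g); rewrite -!actM mulVg !act1.
Qed.

End Action.

Section Rigidity.
Context {dP : Order.disp_t} {P : tbPOrderType dP} {G : groupType} {K : Type}.
Variable D : coding P G K.
Local Notation L := (lat D).
Local Notation pt := (site P G K).
Local Notation nm := (block_name P G K).
Implicit Types (k l : K) (g : G) (p q : P) (x y z : pt) (n m : nm) (e f : L).
Local Notation lt := (klt D).
Local Notation anchor := (anchor D).
Local Notation label := (label D).

Local Notation "x /\m y" := (Order.meet x y) (at level 40).
Local Notation "x \/j y" := (Order.join x y) (at level 45).

(** A strictly increasing self-map of a well-order is nowhere decreasing, so
    that an automorphism, together with its inverse, is the identity. *)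
Lemma strict_mono_ge (f : K -> K) : (forall k l, lt k l -> lt (f k) (f l)) ->
  forall k, ~ lt (f k) k.
Proof.
move=> fm k; elim/(well_founded_ind (klt_wf D)): k => k IH fk.
by apply: (IH _ fk); exact: fm.
Qed.

(** The order of k and l is read off the only cell common to their blocks: it
    contains a second point on the block of the larger index. *)
Lemma ord_direction k l x y : valid D x -> valid D y -> cell D x = cell D y ->
  inc D (OrdB k) x -> inc D (OrdB l) x -> inc D (OrdB l) y -> ~ inc D (OrdB k) y ->
  lt k l.
Proof. by case: x; case: y => //= *; site_cases. Qed.

(** This and the following meets of two blocks are lattice terms for the chains
    of points, through which automorphisms are controlled. *)
Lemma meet_Ord_Ord k l : lt k l ->
  blk D (OrdB k) /\m blk D (OrdB l) = down D (OrdLow k l).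
Proof.
move=> kl; apply: pts_inj; rewrite pts_meet !pts_blk // pts_down_atomic //.
apply/seteqP; split=> [x [[vx kx] [_ lx]]|_ ->]; last by split; split=> //=; auto.
have := klt_neq kl; case: x vx kx lx => //= *; site_cases.
Qed.

Lemma meet_Grp_Ord g k : blk D (GrpB (g * label k)%g) /\m blk D (OrdB k) =
  down D (ActTgt g k).
Proof.
apply: pts_inj; rewrite pts_meet !pts_blk // pts_down_atomic //.
apply/seteqP; split=> [x [[vx gx] [_ kx]]|_ ->]; last by split; split.
by case: x vx kx gx => //= *; site_cases.
Qed.

Lemma meet_Low_Ord p k : proper p ->
  blk D (LowB p) /\m blk D (OrdB k) = down D (ColPt p k).
Proof.
move=> op; apply: pts_inj; rewrite pts_meet !pts_blk // pts_down_atomic //.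
apply/seteqP; split=> [x [[vx gx] [_ kx]]|_ ->]; last by split; split.
by case: x vx kx gx => //= *; site_cases.
Qed.

Lemma meet_Up_Ord p k : proper p -> anchor p <> k ->
  blk D (UpB p) /\m blk D (OrdB k) = down D (ColPt p k).
Proof.
move=> op pk; apply: pts_inj; rewrite pts_meet !pts_blk // pts_down_atomic //.
apply/seteqP; split=> [x [[vx gx] [_ kx]]|_ ->]; last by split; split.
by case: x vx kx gx => //= *; site_cases.
Qed.

Lemma meet_Up_anchor p : proper p ->
  blk D (UpB p) /\m blk D (OrdB (anchor p)) = down D (ColTop p).
Proof.
move=> op; apply: pts_inj; rewrite pts_meet !pts_blk // pts_down //.
apply/seteqP; split=> [x [[vx gx] [_ kx]]|x [->|->|->]]; try by split; split.
case: x vx kx gx => //= [? ? ? ? ?|? ? ? ?]; subst; last by constructor 1.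
by constructor 2.
Qed.

Lemma meet_Up_Up p q : proper p -> proper q -> p < q ->
  blk D (UpB p) /\m blk D (UpB q) = down D (GadTop p q).
Proof.
move=> op oq pq; apply: pts_inj; rewrite pts_meet !pts_blk // pts_down //.
apply/seteqP; split=> [x [[vx gx] [_ kx]]|x [->|->|->]];
  try by split; split=> //=; auto.
have npq : p <> q by move=> e; rewrite e ltxx in pq.
case: x vx kx gx => //= [? ? ? ? ?|? ? ? ?|? ? ? ? ?|? ? ? ? ?|? ? ? ? ?];
  intuition (subst; try congruence; try absurd_order);
  by [constructor 3|constructor 2|constructor 1].
Qed.

Lemma meet_Low_Up p q : proper p -> proper q -> p < q ->
  blk D (LowB p) /\m blk D (UpB q) = down D (GadMid p q).
Proof.
move=> op oq pq; apply: pts_inj; rewrite pts_meet !pts_blk // pts_down //.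
apply/seteqP; split=> [x [[vx gx] [_ kx]]|x [->|->|->]];
  try by split; split=> //=; auto.
have npq : p <> q by move=> e; rewrite e ltxx in pq.
case: x vx kx gx => //= *;
  intuition (subst; try congruence; try absurd_order);
  by [constructor 2|constructor 1].
Qed.

Lemma meet_Low_Low p q : proper p -> proper q -> p < q ->
  blk D (LowB p) /\m blk D (LowB q) = down D (GadBot p q).
Proof.
move=> op oq pq; apply: pts_inj; rewrite pts_meet !pts_blk // pts_down_atomic //.
apply/seteqP; split=> [x [[vx gx] [_ kx]]|_ ->];
  try by split; split=> //=; auto.
have npq : p <> q by move=> e; rewrite e ltxx in pq.
by case: x vx kx gx => //= *;
  intuition (subst; try congruence; try absurd_order).
Qed.

End Rigidity.

(** * There are no further automorphisms *)

Section Automorphisms.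
Context {dP : Order.disp_t} {P : tbPOrderType dP} {G : groupType} {K : Type}.
Variable D : coding P G K.
Local Notation L := (lat D).
Local Notation pt := (site P G K).
Local Notation nm := (block_name P G K).
Implicit Types (k l : K) (g : G) (p q : P) (x y z : pt) (n m : nm) (e f : L).
Local Notation lt := (klt D).
Local Notation anchor := (anchor D).
Local Notation label := (label D).
Local Notation aut := (@is_lattice_automorphism _ L).

Local Notation "x /\m y" := (Order.meet x y) (at level 40).
Local Notation "x \/j y" := (Order.join x y) (at level 45).

Lemma aut_inv (s : L -> L) : aut s ->
  exists t, [/\ aut t, cancel s t & cancel t s].
Proof. by move=> /is_lattice_automorphism_inv [t at_ [st ts]]; exists t. Qed.

Lemma down_bot x : valid D x -> down D x <> lat_bot D.
Proof.
move=> vx e; have : pts (down D x) x by rewrite pts_down //; constructor 1.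
by rewrite e.
Qed.

Lemma aut_bot (s : L -> L) : aut s -> s (lat_bot D) = lat_bot D.
Proof.
move=> /[dup] /automorphism_mono smono /aut_inv [t [_ _ ts]].
by apply: le_anti; rewrite lat_bot_le -{2}(ts (lat_bot D)) smono lat_bot_le.
Qed.

Lemma aut_top (s : L -> L) : aut s -> s (lat_top D) = lat_top D.
Proof.
move=> /[dup] /automorphism_mono smono /aut_inv [t [_ _ ts]].
by apply: le_anti; rewrite le_lat_top -{1}(ts (lat_top D)) smono le_lat_top.
Qed.

(** Automorphisms preserve atoms, and these are the singletons of the minimal
    points. *)
Lemma aut_atom (s : L -> L) x : aut s -> valid D x -> atomic D x ->
  exists y, [/\ valid D y, atomic D y & s (down D x) = down D y].
Proof.
move=> as_ vx ax; have smono := automorphism_mono as_.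
have [t [at_ st ts]] := aut_inv as_; have tmono := automorphism_mono at_.
have [y0 sy0] : exists y, pts (s (down D x)) y.
  apply: contrapT => N; apply: (down_bot vx).
  rewrite -(st (down D x)) -(aut_bot at_); congr t.
  by apply: pts_inj; apply/seteqP; split=> // y sy; case: N; exists y.
have sb := pts_base sy0; have vb := pts_valid sb.
exists (base D y0); split=> //; first exact: base_atomic.
have : t (down D (base D y0)) <= down D x.
  by rewrite -(st (down D x)) tmono; apply/down_le.
move=> tb; have [y1 ty1] : exists y, pts (t (down D (base D y0))) y.
  apply: contrapT => N; apply: (down_bot vb).
  rewrite -(ts (down D _)) -(aut_bot as_); congr s.
  by apply: pts_inj; apply/seteqP; split=> // y sy; case: N; exists y.
rewrite -(ts (down D (base D y0))); congr s; apply: le_anti; rewrite tb andbT.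
apply/(down_le _ vx); move: (tb) => /pts_leP /(_ _ ty1).
by rewrite pts_down_atomic // => /= <-.
Qed.

Lemma not_small_atoms e : ~ small D (pts e) ->
  infinite_set (pts e `&` atomic D).
Proof.
have [k0 _] := infinite_setN0 (idx_infinite D).
case: (lat_cases e) => [->|[n on ->]|//] _.
- by apply: (@inj_infinite _ _ _ _ D Mark _ k0) => [k l []|k _].
- by rewrite pts_blk //; exact: block_atoms_infinite.
Qed.

(** Smallness means having finitely many atoms below. *)
Lemma aut_small (s : L -> L) e : aut s -> small D (pts e) -> small D (pts (s e)).
Proof.
move=> as_ [efin _ _ _]; apply: contrapT => /not_small_atoms; apply.
have [t [at_ st ts]] := aut_inv as_; have tmono := automorphism_mono at_.
have /choice [h hP] x : exists y, valid D x -> atomic D x ->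
    [/\ valid D y, atomic D y & t (down D x) = down D y].
  have [[vx ax]|N] := pselect (valid D x /\ atomic D x).
    by have [y ?] := aut_atom at_ vx ax; exists y.
  by exists x => vx ax; case: N.
have h_inj : {in pts (s e) `&` atomic D &, injective h}.
  move=> x y; rewrite !inE => -[sx ax] [sy ay] hxy.
  have vx := pts_valid sx; have vy := pts_valid sy.
  have [_ _ tx] := hP x vx ax; have [_ _ ty] := hP y vy ay.
  have : down D x = down D y by rewrite -(ts (down D x)) tx hxy -ty ts.
  move=> /(congr1 (fun e : L => pts e x)); rewrite !pts_down_atomic //= => <-.
  by [].
rewrite -(eq_finite_set (inj_card_eq h_inj)); apply: sub_finite_set efin.
move=> _ [x [sx ax] <-]; have vx := pts_valid sx.
have [vh _ th] := hP x vx ax; apply/(down_le _ vh).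
by rewrite -th -(st e) tmono; apply/down_le.
Qed.

Lemma aut_smallE (s : L -> L) e : aut s -> small D (pts (s e)) -> small D (pts e).
Proof.
by move=> /aut_inv [t [at_ st _]] /(aut_small at_); rewrite st.
Qed.

(** Cells become visible in the lattice through atoms with a small join. *)
Lemma small_down2 x y : valid D x -> valid D y -> atomic D x -> atomic D y ->
  small D (pts (down D x \/j down D y)) <-> cell D x = cell D y.
Proof.
move=> vx vy ax ay; split=> [[_ _ _]|cxy].
  by apply; [apply: pts_joinl|apply: pts_joinr]; rewrite pts_down_atomic.
suff s : small D (pts (down D x) `|` pts (down D y)) by rewrite pts_join_small.
rewrite !pts_down_atomic //; split.
- exact: finite_set2.
- by move=> _ [->|->].
- by move=> _ [->|->]; [left; rewrite ax|right; rewrite ay].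
- by move=> _ _ [->|->] [->|->].
Qed.

Lemma aut_cell (s : L -> L) x y x' y' : aut s ->
  valid D x -> valid D y -> valid D x' -> valid D y' ->
  atomic D x -> atomic D y -> atomic D x' -> atomic D y' ->
  s (down D x) = down D x' -> s (down D y) = down D y' ->
  cell D x = cell D y -> cell D x' = cell D y'.
Proof.
move=> as_ vx vy vx' vy' ax ay ax' ay' sx sy /small_down2 H; apply/small_down2 => //.
have [_ _ sj] := as_; rewrite -sx -sy -sj; apply: aut_small => //; exact: H.
Qed.

Lemma aut_blk (s : L -> L) n : aut s -> ok n ->
  exists2 m, ok m & s (blk D n) = blk D m.
Proof.
move=> as_ on; case: (lat_cases (s (blk D n))) => [st|[m om sm]|ss].
- have : blk D n = lat_top D.
    have [t [at_ st' _]] := aut_inv as_.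
    by rewrite -(st' (blk D n)) st aut_top.
  move=> bt; have [k1 [k2 [_ _ k12]]] := infinite_two (idx_infinite D).
  have [_ n1] : block D n (Mark k1) by rewrite -pts_blk // bt.
  have [_ n2] : block D n (Mark k2) by rewrite -pts_blk // bt.
  by case: k12; move: (inc_Mark n2); rewrite (inc_Mark n1); case.
- by exists m.
- by move/(aut_smallE as_): ss; rewrite pts_blk // => /block_not_small; case.
Qed.

Lemma aut_mem (s : L -> L) x x' e : aut s -> valid D x -> valid D x' ->
  s (down D x) = down D x' -> pts e x <-> pts (s e) x'.
Proof.
move=> as_ vx vx' sx; rewrite -(down_le _ vx) -(down_le _ vx') -sx.
by rewrite (automorphism_mono as_).
Qed.

Lemma aut_inc (s : L -> L) x x' n n' : aut s -> valid D x -> valid D x' ->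
  ok n -> ok n' -> s (down D x) = down D x' -> s (blk D n) = blk D n' ->
  inc D n x <-> inc D n' x'.
Proof.
move=> as_ vx vx' on on' sx sn; have := aut_mem (blk D n) as_ vx vx' sx.
by rewrite sn !pts_blk // => -[H H']; split=> i; [case: H|case: H'].
Qed.

(** The cell of the marks is the only infinite one. *)
Lemma aut_Mark (s : L -> L) k : aut s ->
  exists l, s (down D (Mark k)) = down D (Mark l).
Proof.
move=> as_; have [x [vx ax sx]] := aut_atom (x := Mark k) as_ I erefl.
have [xM|xM] := pselect (cell D x = MarkCell).
  by case: x xM {vx ax} sx => // l _ ->; exists l.
have /choice [h hP] (l : K) : exists y,
    [/\ valid D y, atomic D y & s (down D (Mark l)) = down D y].
  exact: aut_atom.
have [k0 _] := infinite_setN0 (idx_infinite D).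
have [] := @inj_infinite _ _ _ _ D h [set y | cell D y = cell D x] k0.
- move=> l l' hl; have [_ _ sl] := hP l; have [_ _ sl'] := hP l'.
  have : down D (Mark l) = down D (Mark l').
    have [t [_ st _]] := aut_inv as_.
    by rewrite -(st (down D (Mark l))) sl hl -sl' st.
  move=> /(congr1 (fun e : L => pts e (Mark l))); rewrite !pts_down_atomic //=.
  by move=> e; have : Mark l = Mark l' :> pt by [rewrite -e]; case.
- move=> l _ /=; have [vl al sl] := hP l.
  exact: (aut_cell (x := Mark l) (y := Mark k) as_).
- exact: cell_finite.
Qed.

Lemma aut_OrdB (s : L -> L) k l : aut s ->
  s (down D (Mark k)) = down D (Mark l) -> s (blk D (OrdB k)) = blk D (OrdB l).
Proof.
move=> as_ sk; have [m om sm] := aut_blk (n := OrdB k) as_ I.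
rewrite sm; congr blk; apply: (@inc_Mark _ _ _ _ D).
by apply/(aut_inc (x := Mark k) (n := OrdB k) as_).
Qed.

Lemma aut_lt (s : L -> L) (h : K -> K) : aut s ->
  (forall k, s (down D (Mark k)) = down D (Mark (h k))) ->
  forall k l, lt k l -> lt (h k) (h l).
Proof.
move=> as_ hP k l kl.
have [x [vx ax sx]] := aut_atom (x := OrdLow k l) as_ kl erefl.
have [y [vy ay sy]] := aut_atom (x := OrdHigh k l) as_ kl erefl.
have B j := aut_OrdB as_ (hP j).
apply: (@ord_direction _ _ _ _ D _ _ x y) => //.
- exact: (aut_cell (x := OrdLow k l) (y := OrdHigh k l) as_).
- by apply/(aut_inc (x := OrdLow k l) (n := OrdB k) as_ _ _ _ _ sx (B k)) => //; left.
- by apply/(aut_inc (x := OrdLow k l) (n := OrdB l) as_ _ _ _ _ sx (B l)) => //; right.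
- by apply/(aut_inc (x := OrdHigh k l) (n := OrdB l) as_ _ _ _ _ sy (B l)).
- move/(aut_inc (x := OrdHigh k l) (n := OrdB k) (n' := OrdB (h k)) as_ kl vy I I sy (B k)) => /= lk.
  by rewrite lk in kl; exact: klt_irr kl.
Qed.

Lemma aut_fix_Mark (s : L -> L) k : aut s -> s (down D (Mark k)) = down D (Mark k).
Proof.
move=> as_; have [t [at_ st ts]] := aut_inv as_.
have /choice [h hP] := fun k => aut_Mark k as_.
have /choice [h' h'P] := fun k => aut_Mark k at_.
have hh' : h' (h k) = k.
  have : down D (Mark (h' (h k))) = down D (Mark k) by rewrite -h'P -hP st.
  move=> /(congr1 (fun e : L => pts e (Mark k))); rewrite !pts_down_atomic //=.
  by move=> e; have : Mark k = Mark (h' (h k)) :> pt by [rewrite e]; case.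
have N1 := strict_mono_ge (aut_lt as_ hP) (k := k).
have N2 := strict_mono_ge (aut_lt at_ h'P) (k := h k); rewrite hh' in N2.
rewrite hP; have [-> //|ne] := pselect (h k = k).
by case: (klt_total D ne).
Qed.

Lemma aut_fix_OrdB (s : L -> L) k : aut s -> s (blk D (OrdB k)) = blk D (OrdB k).
Proof. by move=> as_; apply: aut_OrdB => //; exact: aut_fix_Mark. Qed.

Lemma aut_blk_inj (s : L -> L) n n' m : aut s -> ok n -> ok n' ->
  s (blk D n) = blk D m -> s (blk D n') = blk D m -> n = n'.
Proof.
move=> /aut_inv [t [_ st _]] on on' sn sn'; apply: (@blk_inj _ _ _ _ D) => //.
by rewrite -(st (blk D n)) sn -sn' st.
Qed.

(** Among the blocks other than [OrdB k], the upper block of p is the only one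
    whose meet with [OrdB (anchor p)] is not an atom. *)
Lemma aut_fix_UpB (s : L -> L) p : aut s -> proper p ->
  s (blk D (UpB p)) = blk D (UpB p).
Proof.
move=> as_ op; have [m om sm] := aut_blk (n := UpB p) as_ op.
have [t [at_ st ts]] := aut_inv as_.
have [sI _] : Order.meet_morphism s /\ True by case: as_.
have smeet : s (down D (ColTop p)) = blk D m /\m blk D (OrdB (anchor p)).
  by rewrite -meet_Up_anchor // sI sm aut_fix_OrdB.
(* the chain of [ColTop p] has two points, so its image is not an atom *)
suff Natom x : valid D x -> atomic D x -> s (down D (ColTop p)) <> down D x.
  rewrite sm; case: m om sm smeet => [k|g|q|q] om sm smeet.
  - have := aut_blk_inj (n := UpB p) (n' := OrdB k) as_ op I sm (aut_fix_OrdB k as_).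
    by [].
  - case: (Natom (ActTgt (g * (label (anchor p))^-1)%g (anchor p))) => //.
    rewrite smeet -meet_Grp_Ord; congr (blk _ _ /\m _).
    by congr GrpB; rewrite mulgVK.
  - by case: (Natom (ColPt q (anchor p))) => //; rewrite smeet meet_Low_Ord.
  - have [->//|qp] := pselect (q = p).
    case: (Natom (ColPt q (anchor p))) => //; rewrite smeet meet_Up_Ord //.
    by move=> /anchor_inj.
move=> vx ax sx; have [y [vy ay ty]] := aut_atom at_ vx ax.
have : down D (ColTop p) = down D y by rewrite -ty -sx st.
move=> e; have : pts (down D y) (ColTop p) by rewrite -e pts_down //; constructor 1.
have : pts (down D y) (ColPt p (anchor p)) by rewrite -e pts_down //; constructor 2.
by rewrite pts_down_atomic // => <-.
Qed.

Lemma aut_fix_LowB (s : L -> L) p : aut s -> proper p ->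
  s (blk D (LowB p)) = blk D (LowB p).
Proof.
move=> as_ op; have [m om sm] := aut_blk (n := LowB p) as_ op.
have : blk D m <= blk D (UpB p).
  by rewrite -sm -(aut_fix_UpB as_ op) (automorphism_mono as_) low_le_up.
have ou : ok (UpB p : nm) by exact: op.
move=> /(blk_le om ou) [mu|/nestedP [q mq [pq]]].
  subst m; have := aut_blk_inj (n := LowB p) (n' := UpB p) as_ op op sm (aut_fix_UpB as_ op).
  by [].
by rewrite sm mq pq.
Qed.

Lemma aut_GrpB (s : L -> L) g : aut s ->
  exists g', s (blk D (GrpB g)) = blk D (GrpB g').
Proof.
move=> as_; have [m om sm] := aut_blk (n := GrpB g) as_ I.
case: m om sm => [k|g'|q|q] om sm; last 2 first.
- by have := aut_blk_inj (n := GrpB g) (n' := LowB q) as_ I om sm (aut_fix_LowB as_ om).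
- by have := aut_blk_inj (n := GrpB g) (n' := UpB q) as_ I om sm (aut_fix_UpB as_ om).
- by have := aut_blk_inj (n := GrpB g) (n' := OrdB k) as_ I I sm (aut_fix_OrdB k as_).
- by exists g'.
Qed.

(** The graph of right multiplication by the label of k is read off the cells
    that meet [OrdB k]. *)
Lemma act_relation g h k x y : valid D x -> valid D y -> cell D x = cell D y ->
  inc D (OrdB k) y -> inc D (GrpB h) y ->
  inc D (GrpB g) x -> ~ inc D (OrdB k) x -> h = (g * label k)%g.
Proof. by case: x; case: y => //= *; site_cases. Qed.

Lemma aut_GrpB_mul (s : L -> L) g g' k : aut s ->
  s (blk D (GrpB g)) = blk D (GrpB g') ->
  s (blk D (GrpB (g * label k)%g)) = blk D (GrpB (g' * label k)%g).
Proof.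
move=> as_ sg; have [h sh] := aut_GrpB (g * label k)%g as_.
have [x [vx ax sx]] := aut_atom (x := ActSrc g k) as_ I erefl.
have [y [vy ay sy]] := aut_atom (x := ActTgt g k) as_ I erefl.
rewrite sh; congr (blk D (GrpB _)).
apply: (act_relation (x := x) (y := y) (k := k)) => //.
- exact: (aut_cell (x := ActSrc g k) (y := ActTgt g k) as_).
- by apply/(aut_inc (x := ActTgt g k) (n := OrdB k) as_ _ _ _ _ sy (aut_fix_OrdB k as_)).
- by apply/(aut_inc (x := ActTgt g k) as_ _ _ _ _ sy sh).
- by apply/(aut_inc (x := ActSrc g k) as_ _ _ _ _ sx sg).
- by move/(aut_inc (x := ActSrc g k) (n := OrdB k) (n' := OrdB k) as_ I vx I I sx (aut_fix_OrdB k as_)).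
Qed.

(** All points are meets of two fixed blocks, except marks and the points
    [OrdHigh k l] and [ActSrc g k]; these last are fixed because the only other
    point in their cell is. *)
Lemma aut_fix_id (s : L -> L) : aut s ->
  (forall g, s (blk D (GrpB g)) = blk D (GrpB g)) -> forall e, s e = e.
Proof.
move=> as_ sG; have [_ sI _] := as_.
have sO k := aut_fix_OrdB k as_.
have sL p op := @aut_fix_LowB s p as_ op.
have sU p op := @aut_fix_UpB s p as_ op.
(* a minimal point is fixed if it shares its cell with one other point only,
   and that point is fixed *)
have mate x y : valid D x -> valid D y -> atomic D x -> atomic D y -> x <> y ->
    (forall z, cell D z = cell D x -> z = x \/ z = y) -> cell D y = cell D x ->
    s (down D x) = down D x -> s (down D y) = down D y.
  move=> vx vy ax ay xy cx cyx sx; have [z [vz az sz]] := aut_atom as_ vy ay.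
  have [zx|zy] : z = x \/ z = y; last by rewrite sz zy.
    by apply: cx; exact: (aut_cell as_ vy vx vz vx ay ax az ax sz sx).
  - subst z; have : down D x = down D y.
      by have [t [_ st _]] := aut_inv as_; rewrite -(st (down D x)) sx -sz st.
    move=> /(congr1 (fun e : L => pts e x)); rewrite !pts_down_atomic //= => e.
    by case: xy; rewrite -e.
have fixd x : valid D x -> s (down D x) = down D x.
  case: x => [k|k l|k l|g k|g k|p k|p|p q|p q|p q] /= vx.
  - exact: aut_fix_Mark.
  - by rewrite -meet_Ord_Ord // sI !sO.
  - apply: (mate (OrdLow k l)) => //; last by rewrite -meet_Ord_Ord // sI !sO.
    by case=> //= a b; case=> -> ->; [left|right].
  - apply: (mate (ActTgt g k)) => //; last by rewrite -meet_Grp_Ord sI sO sG.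
    by case=> //= a b; case=> -> ->; [right|left].
  - by rewrite -meet_Grp_Ord sI sO sG.
  - by rewrite -meet_Low_Ord // sI sO sL.
  - by rewrite -meet_Up_anchor // sI sO sU.
  - by case: vx => [op [oq pq]]; rewrite -meet_Low_Low // sI !sL.
  - by case: vx => [op [oq pq]]; rewrite -meet_Low_Up // sI sL ?sU.
  - by case: vx => [op [oq pq]]; rewrite -meet_Up_Up // sI !sU.
move=> e; apply: pts_inj; apply/seteqP; split=> x ex; have vx := pts_valid ex.
  by apply/(aut_mem e as_ vx vx (fixd x vx)).
by apply/(aut_mem e as_ vx vx (fixd x vx)).
Qed.

(** The image of [GrpB 1] determines an automorphism: after composition with a
    translation it fixes every block. *)
Theorem Aut_isomorphic : group_isomorphic (Aut L) G.
Proof.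
pose u a : Aut L := mkAut (act_automorphism D a).
have uM : {morph u : a b / (a * b)%g}.
  by move=> a b; apply: val_inj; apply/funext => e; exact: actM.
have u_inj : injective u.
  move=> a b /(congr1 val) /= ab.
  have : act a (blk D (GrpB 1%g)) = act b (blk D (GrpB 1%g)) by rewrite ab.
  by rewrite !act_blk //= !mulg1 => /(@blk_inj _ _ _ _ D (GrpB a) (GrpB b) I I) [].
have u_surj (s : Aut L) : exists a, u a = s.
  have as_ := AutP s.
  have [a sa] := aut_GrpB 1%g as_; exists a; apply: val_inj; apply/funext => e /=.
  have sg g : val s (blk D (GrpB g)) = blk D (GrpB (a * g)%g).
    have [k <-] := label_surj D g.
    by have := aut_GrpB_mul k as_ sa; rewrite mul1g.
  have at_ := is_lattice_automorphism_comp (act_automorphism D a^-1%g) as_.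
  have /= fix_ : forall e, act a^-1%g (val s e) = e.
    by apply: (aut_fix_id at_) => g /=; rewrite sg act_blk //= mulKg.
  by rewrite -{1}(fix_ e) -actM mulgV act1.
have /choice [f fK] := u_surj.
have uK : cancel u f by move=> a; apply: u_inj; rewrite fK.
exists f; split; first by exists u.
by move=> s t; apply: u_inj; rewrite uM !fK.
Qed.

End Automorphisms.

(** * The representation theorem *)

Local Close Scope order_scope.

Lemma coding_exists dP (P : tbPOrderType dP) (G : groupType) (K : Type) :
  (exists x y : P, x <> y) -> infinite_set [set: K] ->
  [set: P] #<= [set: K] -> [set: G] #<= [set: K] ->
  $|coding P G K|.
Proof.
move=> [x [y xy]] Kinf KP KG.
have K0 := infinite_setN0 Kinf.
have [lt [lt_wf lt_trans lt_irr lt_total]] := well_ordering K.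
have [a a_inj] := card_le_injective K0 KP.
have [b b_inj] := card_le_injective K0 KG.
have [l l_surj] := injective_surjection (ex_intro _ 1%g I) b_inj.
squash (Coding lt_wf lt_trans lt_irr lt_total a_inj l_surj Kinf
  (_ : \bot <> \top :> P)%O).
move=> bt; apply: xy.
have all_bot (z : P) : z = \bot%O by apply: le_anti; rewrite {1}bt lex1 le0x.
by rewrite (all_bot x) (all_bot y).
Qed.

Theorem theorem1p3
  (dP : Order.disp_t) (P : tbPOrderType dP) (P_ge2 : exists x y : P, x <> y)
  (G : groupType)
  (K : Type) (K_infinite : infinite_set [set: K])
  (K_geP : [set: P] #<= [set: K]) (K_geG : [set: G] #<= [set: K]) :
  exists (dL : Order.disp_t) (L : latticeType dL),
    (* (a) *)
    ([/\ Id L #= [set: set K],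
         Filt L #= [set: K],
         [set: L] #= [set: K] &
         Filt L #<= Id L /\ ~ (Id L #<= Filt L)]) /\
    (* (b) *)
    order_isomorphic (Princ L) P /\
    (* (c): the equality relation is excluded, since it is the principal
       congruence con(a, a) and is not generated by any prime interval *)
    (forall theta : set (L * L), is_principal theta -> theta <> diagonal ->
       exists a b : L, prime_interval a b /\ theta = con a b) /\
    (* (d) *)
    group_isomorphic (Aut L) G.
Proof.
have [D] := coding_exists P_ge2 K_infinite K_geP K_geG.
exists set_display, (lat D : latticeType set_display); split; first split.
- exact: card_Id_lat.
- exact: card_Filt_lat.
- exact: card_lat.
- exact: Filt_lt_Id.
split; first exact: Princ_isomorphic.
split; first exact: principal_prime.
exact: Aut_isomorphic.
Qed.
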